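(* Let $f:[0,1]\to\mathbb{R}$ be a $C^1$ function of type C, i.e. $f(0)=f(1)=0$ and there is $u_0\in(0,1)$ with $f(u_0)=0$, $f(u)<0$ for $u\in(0,u_0)$ and $f(u)>0$ for $u\in(u_0,1)$. Put $f^+=\max\{f,0\}$, $f^-=\max\{-f,0\}$, $F^+=\int_0^1 f^+(u)\,du$, $F^-=\int_0^1 f^-(u)\,du$, and assume $$\int_0^1 f(u)\,du>0\qquad\text{and}\qquad \int_0^1 f^-(u)\,du<1 .$$ Let $h:[0,1]\to\mathbb{R}$ be a $C^1$ function with $h(0)=0$, $h'(u)>0$ for every $u\in(0,1)$, and $h(u_0)<1+h(0)$. Fix $\eta$ with $0<\eta<\min\{F^+,1\}-F^-$. Assume $$h(u_0)-h(0)<\frac{1-F^--\eta}{\sqrt{(F^-+\eta)(2-F^--\eta)}}\,\eta$$ and, moreover, that one of the following holds: 1) $F^+<1$ and $$h(1)-h(u_0)<\frac{1-F^+}{\sqrt{F^+(2-F^+)}}\,(F^+-F^--\eta);$$ 2) $F^+\ge 1$ and, for fixed constants $0<\zeta<1-F^--\eta$ and $\xi_0\in(u_0,1)$ such that $\int_{\xi_0}^1 f(u)\,du=1-\zeta$, $$h(\xi_0)-h(u_0)<\sqrt{1-\Big(\frac{1+\zeta-F^--\eta}{2}\Big)^2}-\sqrt{1-(1-F^--\eta)^2},$$ $$h(1)-h(\xi_0)<\frac{1-\zeta-F^--\eta}{2}\,\frac{\zeta}{\sqrt{1-\zeta^2}} .$$ Then there exists a positive admissible speed, i.e. some $c>0$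 for which the problem $$\begin{cases} y'=(c+h'(u))\dfrac{\sqrt{y(2-y)}}{1-y}-f(u),\\ y(0)=0,\quad y(1)=0,\quad 0<y(u)<1\ \text{ for } u\in(0,1)\end{cases}$$ has a solution.
   Context: A solution is a function $y$, continuous on $[0,1]$, satisfying the differential equation on $(0,1)$ together with the stated boundary conditions and bounds. A speed $c\in\mathbb{R}$ is called admissible if the displayed first-order two-point problem is solvable. *)

(* Defs.v *)
From Stdlib Require Import Reals Lra.
From Coquelicot Require Import Coquelicot.
Open Scope R_scope.

(* Functions on [0,1] are total functions R -> R of which only the values on
   [0,1] are constrained; their values elsewhere are irrelevant. *)
Definition I01 (u : R) : Prop := 0 <= u <= 1.

(* [D_in] is the limit of difference quotients taken within [D], so that for
   D = [0,1] the derivative is one-sided at the endpoints. *)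
Definition C1_on (D : R -> Prop) (f : R -> R) : Prop :=
  exists df : R -> R,
    (forall x, D x -> D_in f df D x) /\ continuous_on D df.

Definition type_C (f : R -> R) (u0 : R) : Prop :=
  f 0 = 0 /\ f 1 = 0 /\
  0 < u0 < 1 /\ f u0 = 0 /\
  (forall u, 0 < u < u0 -> f u < 0) /\
  (forall u, u0 < u < 1 -> 0 < f u).

Definition pos_part (f : R -> R) (u : R) : R := Rmax (f u) 0.
Definition neg_part (f : R -> R) (u : R) : R := Rmax (- f u) 0.

Definition Fplus (f : R -> R) : R := RInt (pos_part f) 0 1.
Definition Fminus (f : R -> R) : R := RInt (neg_part f) 0 1.

(* The equation is imposed on the open interval only, where [Derive h] is the
   ordinary derivative of a function h that is C^1 on [0,1]. *)
Definition is_solution (f h : R -> R) (c : R) (y : R -> R) : Prop :=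
  continuous_on I01 y /\
  (forall u, 0 < u < 1 ->
     is_derive y u
       ((c + Derive h u) * (sqrt (y u * (2 - y u)) / (1 - y u)) - f u)) /\
  y 0 = 0 /\ y 1 = 0 /\
  (forall u, 0 < u < 1 -> 0 < y u < 1).

Definition admissible (f h : R -> R) (c : R) : Prop :=
  exists y : R -> R, is_solution f h c y.

(* Main.v *)
Require Import Defs.
From Stdlib Require Import Reals Lra Lia.
From Coquelicot Require Import Coquelicot.
Open Scope R_scope.

(** The substitution w = sqrt (y (2 - y)), that is y = 1 - sqrt (1 - w^2), turns the
equation into w' = c + h' - f phi(w) with phi(w) = sqrt (1 - w^2) / w.  The
singularity at y = 0 becomes a pole of phi, but phi is decreasing, and this is what
makes everything work.  On [0,u0], where f <= 0, the right-hand side decreases in w,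
so that solutions issued from w(0) = 0 contract forwards; on [u0,1], where f >= 0, it
increases in w, so that solutions issued from w(1) = 0 contract backwards.  With
s = 1 - u in the second case, both are the same initial value problem
w' = a(t) + p(t) phi(w), w(0) = 0, with p >= 0: the drift a is c + h' and the force p
is the negative part of f on the left, and a = -(c + h'), p = the positive part of f
on the right.

This problem is solved by truncating phi to a Lipschitz function that agrees with it
on [M / (n + 1), M], where M < 1 is fixed, and letting n tend to infinity.  By the
maximum principle ([comparison]) the truncated solutions increase with n, and their
limit [sing_sol] is positive at every time t > 0 at which the force is ([sing_sol_pos]); where it is
positive it satisfies the equation ([sing_sol_derive]), because there it coincides
with a solution of a single truncated problem.  The same principle shows that the limit is
monotone and Lipschitz in the drift ([sing_sol_drift]), hence continuous in c.

Shoot from both ends towards u0 and let c vary.  At c = 0 the left solution arrives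
strictly below sqrt (b (2 - b)), where b = F^- + eta ([sing_sol_lt_chord]): as long as
y <= b one has y' <= h' g(b) + f^-, where g(y) = sqrt (y (2 - y)) / (1 - y), and the
hypothesis on h(u0) says exactly that the integral of this bound stays below b.  The
right solution arrives at or above that value: as long as y <= I < 1, running
backwards it grows at least like the integral of f^+ - g(I) h'
([sing_sol_ge_chord]).  With I = F^+ this settles the case F^+ < 1; otherwise it is
used on [xi0,1] with I = 1 - zeta, and on [u0,xi0] one uses that w loses at most the
increment of h ([sing_sol_gain]).  For c = 2 / u0 the left solution arrives at 2 or above,
whereas the right one stays below M.  At an intermediate speed both meet
([matching_speed]).  Since f(u0) = 0, the two halves join with equal derivatives, and
w <= M < 1 everywhere, so that the truncation is invisible and y = 1 - sqrt (1 - w^2)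
is a solution ([matched_solution]).

The cap M can be chosen independently of c: backwards from u = 1, w <= sqrt (2 P s) with P a
bound of f, and away from u = 1 the derivative h' has a positive minimum up to u0, so
that w cannot cross a level M at which phi is small enough ([sing_sol_le_cap]). *)

(** * Continuity, mean value, and the maximum principle *)

Lemma lipschitz_continuous (f : R -> R) (K x : R) :
  (forall y, Rabs (f y - f x) <= K * Rabs (y - x)) -> continuous f x.
Proof.
  intros H. apply continuity_pt_filterlim.
  intros eps He.
  exists (eps / (Rabs K + 1)). pose proof (Rabs_pos K).
  split.
  - apply Rdiv_lt_0_compat; lra.
  - intros y [_ Hy]. simpl in *. unfold R_dist in *.
    apply Rle_lt_trans with (1 := H y).
    apply Rle_lt_trans with ((Rabs K + 1) * Rabs (y - x)).
    + apply Rmult_le_compat_r; [apply Rabs_pos|]. pose proof (Rle_abs K). lra.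
    + apply Rmult_lt_compat_l with (r := Rabs K + 1) in Hy; [|lra].
      replace ((Rabs K + 1) * (eps / (Rabs K + 1))) with eps in Hy by (field; lra).
      exact Hy.
Qed.

Lemma continuous_pos_near (f : R -> R) (x a : R) :
  continuous f x -> a < f x ->
  exists d, 0 < d /\ forall y, Rabs (y - x) < d -> a < f y.
Proof.
  intros Hc Hp.
  destruct (Hc (fun z => a < z)) as [d Hd].
  { assert (Hp' : 0 < f x - a) by lra. exists (mkposreal _ Hp'). intros z Hz.
    change (Rabs (z - f x) < f x - a) in Hz. apply Rabs_def2 in Hz. lra. }
  exists d. split; [apply cond_pos|]. intros y Hy. apply Hd. exact Hy.
Qed.

(** Unlike [MVT_gen], the intermediate point is interior, so that nothing is asked
    of [d'] at the end points. *)
Lemma mean_value (d d' : R -> R) (s t : R) :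
  s < t ->
  (forall r, s <= r <= t -> continuous d r) ->
  (forall r, s < r < t -> is_derive d r (d' r)) ->
  exists r, s < r < t /\ d t - d s = d' r * (t - s).
Proof.
  intros Hst Hc Hd.
  assert (pr1 : forall r, s < r < t -> derivable_pt d r).
  { intros r Hr. exists (d' r). apply is_derive_Reals. auto. }
  assert (pr2 : forall r, s < r < t -> derivable_pt id r).
  { intros r _. apply derivable_pt_id. }
  destruct (MVT d id s t pr1 pr2 Hst) as [r [Hr E]].
  - intros r Hr. apply continuity_pt_filterlim. apply Hc. exact Hr.
  - intros r _. apply derivable_continuous_pt, derivable_pt_id.
  - exists r. split; [exact Hr|].
    rewrite (derive_pt_eq_0 _ _ (d' r) (pr1 r Hr)) in E.
    2: apply is_derive_Reals; auto.
    rewrite (derive_pt_eq_0 _ _ 1 (pr2 r Hr)) in E.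
    2: apply derivable_pt_lim_id.
    unfold id in E. lra.
Qed.

(** The maximum principle on which the later estimates rest. Derivatives are
    compared only where the order to be proved fails; for fields that decrease in
    the unknown, this is where they point the right way. *)
Lemma comparison (u v u' v' : R -> R) (s t : R) :
  s <= t ->
  (forall r, s <= r <= t -> continuous u r) ->
  (forall r, s <= r <= t -> continuous v r) ->
  (forall r, s < r < t -> is_derive u r (u' r)) ->
  (forall r, s < r < t -> is_derive v r (v' r)) ->
  u s <= v s ->
  (forall r, s < r < t -> v r < u r -> u' r <= v' r) ->
  u t <= v t.
Proof.
  intros Hst Cu Cv Du Dv H0 H.
  destruct (Rle_or_lt (u t) (v t)) as [|Hlt]; [assumption|exfalso].
  (* m is the last point at which d <= 0; beyond it d > 0, so that d cannot
     increase. *)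
  set (d := fun r => u r - v r).
  assert (Cd : forall r, s <= r <= t -> continuous d r).
  { intros r Hr. apply (continuous_minus u v); auto. }
  destruct (completeness (fun x => s <= x <= t /\ d x <= 0)) as [m [Hub Hlub]].
  { exists t. intros x [Hx _]. lra. }
  { exists s. split; unfold d; lra. }
  assert (Hsm : s <= m) by (apply Hub; split; unfold d; lra).
  assert (Hmt : m <= t) by (apply Hlub; intros x [Hx _]; lra).
  assert (Hdm : d m <= 0).
  { destruct (Rle_or_lt (d m) 0) as [|Hp]; [assumption|exfalso].
    destruct (continuous_pos_near d m 0 (Cd m (conj Hsm Hmt)) Hp) as [e [He Hn]].
    assert (m <= m - e / 2).
    { apply Hlub. intros x Hx. destruct (Rle_or_lt x (m - e / 2)); [assumption|].
      assert (x <= m) by (apply Hub; exact Hx).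
      assert (0 < d x) by (apply Hn; apply Rabs_def1; lra). lra. }
    lra. }
  assert (Hmt' : m < t).
  { destruct Hmt as [|E]; [assumption|]. rewrite E in Hdm. unfold d in Hdm. lra. }
  destruct (mean_value d (fun r => u' r - v' r) m t Hmt') as [r [Hr E]].
  { intros r Hr. apply Cd. lra. }
  { intros r Hr. apply (is_derive_minus u v); [apply Du|apply Dv]; lra. }
  assert (0 < d r).
  { destruct (Rle_or_lt (d r) 0); [|assumption].
    assert (r <= m) by (apply Hub; split; [lra|assumption]). lra. }
  assert (u' r <= v' r) by (apply H; unfold d in *; lra).
  assert ((u' r - v' r) * (t - m) <= 0) by nra.
  unfold d in *. lra.
Qed.

Lemma is_derive_continuous (f : R -> R) (x l : R) : is_derive f x l -> continuous f x.
Proof.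
  intros H. apply (ex_derive_continuous (V := R_NormedModule)). exists l. exact H.
Qed.

Lemma is_derive_affine (b K s r : R) :
  is_derive (fun x => b + K * (x - s)) r K.
Proof. auto_derive; [trivial|ring]. Qed.

Lemma continuous_affine (b K s r : R) :
  continuous (fun x => b + K * (x - s)) r.
Proof. apply is_derive_continuous with K. apply is_derive_affine. Qed.

Lemma nondecreasing_of_derive (u u' : R -> R) (K s t : R) :
  s <= t ->
  (forall r, s <= r <= t -> continuous u r) ->
  (forall r, s < r < t -> is_derive u r (u' r)) ->
  (forall r, s < r < t -> K <= u' r) ->
  u s + K * (t - s) <= u t.
Proof.
  intros Hst Cu Du H.
  apply (comparison (fun r => u s + K * (r - s)) u (fun _ => K) u' s t); auto.
  - intros; apply continuous_affine.
  - intros; apply is_derive_affine.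
  - lra.
Qed.

(** * Global solutions of bounded Lipschitz equations *)

Record lipschitz_field (G : R -> R -> R) (B L : R) : Prop := {
  field_continuous : forall y : R -> R, (forall t, continuous y t) ->
    forall t, continuous (fun s => G s (y s)) t;
  field_bounded : forall s x, Rabs (G s x) <= B;
  field_lipschitz : forall s x y, Rabs (G s x - G s y) <= L * Rabs (x - y) }.

Lemma field_bound_nonneg G B L : lipschitz_field G B L -> 0 <= B.
Proof.
  intros HG. pose proof (field_bounded _ _ _ HG 0 0). pose proof (Rabs_pos (G 0 0)). lra.
Qed.

(** The truncation of the upper bound by [Rmax] makes every iterate constant before
    [t0], so that the iterates are continuous functions on the whole line. *)
Definition picard_step (G : R -> R -> R) (t0 y0 : R) (y : R -> R) (t : R) : R :=
  y0 + RInt (fun s => G s (y s)) t0 (Rmax t0 t).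

Fixpoint picard_iter (G : R -> R -> R) (t0 y0 : R) (n : nat) : R -> R :=
  match n with
  | O => fun _ => y0
  | S n => picard_step G t0 y0 (picard_iter G t0 y0 n)
  end.

Definition picard (G : R -> R -> R) (t0 y0 t : R) : R :=
  real (Lim_seq (fun n => picard_iter G t0 y0 n t)).

Lemma Rmax_nonexpansive (a x y : R) : Rabs (Rmax a x - Rmax a y) <= Rabs (x - y).
Proof.
  unfold Rmax; destruct (Rle_dec a x), (Rle_dec a y); unfold Rabs;
  repeat destruct Rcase_abs; lra.
Qed.

Lemma Rmin_nonexpansive (a x y : R) : Rabs (Rmin a x - Rmin a y) <= Rabs (x - y).
Proof.
  unfold Rmin; destruct (Rle_dec a x), (Rle_dec a y); unfold Rabs;
  repeat destruct Rcase_abs; lra.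
Qed.

Lemma ex_RInt_cont (g : R -> R) (a b : R) :
  (forall t, continuous g t) -> ex_RInt g a b.
Proof. intros H. apply (ex_RInt_continuous (V := R_CompleteNormedModule)). auto. Qed.

Lemma RInt_lipschitz (g : R -> R) (B a x y : R) :
  (forall t, continuous g t) -> (forall t, Rabs (g t) <= B) ->
  Rabs (RInt g a x - RInt g a y) <= B * Rabs (x - y).
Proof.
  intros Hc HB.
  assert (E : RInt g a x - RInt g a y = RInt g y x).
  { rewrite <- (RInt_Chasles g a y x); try apply ex_RInt_cont; auto.
    unfold plus; simpl. ring. }
  rewrite E.
  destruct (Rle_or_lt y x) as [H|H].
  - rewrite (Rabs_right (x - y)) by lra. rewrite Rmult_comm.
    apply abs_RInt_le_const; auto. apply ex_RInt_cont; auto.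
  - rewrite <- (opp_RInt_swap g) by (apply ex_RInt_cont; auto).
    change (Rabs (- RInt g x y) <= B * Rabs (x - y)).
    rewrite Rabs_Ropp, (Rabs_left (x - y)) by lra.
    replace (B * - (x - y)) with ((y - x) * B) by ring.
    apply abs_RInt_le_const; auto. lra. apply ex_RInt_cont; auto.
Qed.

Lemma is_derive_RInt_cont (g : R -> R) (a t : R) :
  (forall s, continuous g s) -> is_derive (fun x => RInt g a x) t (g t).
Proof.
  intros Hc. apply (is_derive_RInt g (fun x => RInt g a x) a t); auto.
  apply filter_forall. intros x. apply (RInt_correct g), ex_RInt_cont, Hc.
Qed.

Lemma picard_step_lipschitz G B L t0 y0 y s t :
  lipschitz_field G B L -> (forall t, continuous y t) ->
  Rabs (picard_step G t0 y0 y s - picard_step G t0 y0 y t) <= B * Rabs (s - t).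
Proof.
  intros HG Hy. unfold picard_step.
  match goal with |- Rabs (y0 + ?a - (y0 + ?b)) <= _ =>
    replace (y0 + a - (y0 + b)) with (a - b) by ring end.
  apply Rle_trans with (B * Rabs (Rmax t0 s - Rmax t0 t)).
  - apply RInt_lipschitz.
    + apply (field_continuous _ _ _ HG), Hy.
    + intros r. apply (field_bounded _ _ _ HG).
  - apply Rmult_le_compat_l; [|apply Rmax_nonexpansive].
    apply (field_bound_nonneg _ _ _ HG).
Qed.

Lemma picard_step_continuous G B L t0 y0 y t :
  lipschitz_field G B L -> (forall t, continuous y t) ->
  continuous (picard_step G t0 y0 y) t.
Proof.
  intros HG Hy. apply (lipschitz_continuous _ B). intros s.
  eapply picard_step_lipschitz; eauto.
Qed.

Lemma picard_step_derive G B L t0 y0 y t :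
  lipschitz_field G B L -> (forall t, continuous y t) -> t0 < t ->
  is_derive (picard_step G t0 y0 y) t (G t (y t)).
Proof.
  intros HG Hy Ht.
  apply (is_derive_ext_loc (fun x => y0 + RInt (fun s => G s (y s)) t0 x)).
  - assert (Hp : 0 < t - t0) by lra. exists (mkposreal _ Hp). intros x Hx.
    change (Rabs (x - t) < t - t0) in Hx. apply Rabs_def2 in Hx.
    unfold picard_step. rewrite Rmax_right by lra. reflexivity.
  - pose proof (is_derive_RInt_cont _ t0 t (field_continuous _ _ _ HG y Hy)) as Hd.
    rewrite <- (Rplus_0_l (G t (y t))).
    exact (is_derive_plus (fun _ => y0) _ t _ _ (is_derive_const y0 t) Hd).
Qed.

Lemma picard_step_before G t0 y0 y t : t <= t0 -> picard_step G t0 y0 y t = y0.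
Proof.
  intros H. unfold picard_step. rewrite Rmax_left by lra. rewrite RInt_point.
  unfold zero; simpl. ring.
Qed.

Lemma picard_iter_continuous G B L t0 y0 n t :
  lipschitz_field G B L -> continuous (picard_iter G t0 y0 n) t.
Proof.
  intros HG. revert t. induction n; intros t; simpl.
  - apply continuous_const.
  - eapply picard_step_continuous; eauto.
Qed.

(** In the weighted norm with weight exp (2 L (t - t0)) the Picard map halves
    distances, on the whole half line at once. *)
Lemma picard_step_contraction G B L t0 y0 y z K :
  lipschitz_field G B L -> 0 < L -> 0 <= K ->
  (forall t, continuous y t) -> (forall t, continuous z t) ->
  (forall t, t0 <= t -> Rabs (y t - z t) <= K * exp (2 * L * (t - t0))) ->
  forall t, t0 <= t ->
  Rabs (picard_step G t0 y0 y t - picard_step G t0 y0 z t)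
    <= K / 2 * exp (2 * L * (t - t0)).
Proof.
  intros HG HL HK Cy Cz H t Ht.
  set (E := fun x => K / 2 * exp (2 * L * (x - t0))).
  assert (DE : forall x, is_derive E x (L * (K * exp (2 * L * (x - t0))))).
  { intros x. unfold E. auto_derive; [trivial|]. unfold Rminus. field. }
  assert (CE : forall x, continuous E x).
  { intros x. eapply is_derive_continuous. apply DE. }
  assert (E0 : 0 <= E t0).
  { unfold E. apply Rmult_le_pos; [lra|]. apply Rlt_le, exp_pos. }
  assert (Hone : forall a b, (forall t, continuous a t) -> (forall t, continuous b t) ->
     (forall t, t0 <= t -> Rabs (a t - b t) <= K * exp (2 * L * (t - t0))) ->
     picard_step G t0 y0 a t - picard_step G t0 y0 b t <= E t).
  { intros a b Ca Cb Hab.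
    apply (comparison
      (fun x => picard_step G t0 y0 a x - picard_step G t0 y0 b x) E
      (fun x => G x (a x) - G x (b x))
      (fun x => L * (K * exp (2 * L * (x - t0)))) t0 t Ht); auto.
    - intros r _. apply (continuous_minus (picard_step G t0 y0 a) (picard_step G t0 y0 b));
      eapply picard_step_continuous; eauto.
    - intros r Hr. apply (is_derive_minus (picard_step G t0 y0 a) (picard_step G t0 y0 b));
      eapply picard_step_derive; eauto; lra.
    - rewrite !picard_step_before by lra. lra.
    - intros r Hr _. apply Rle_trans with (1 := Rle_abs _).
      apply Rle_trans with (1 := field_lipschitz _ _ _ HG r (a r) (b r)).
      apply Rmult_le_compat_l; [lra|]. apply Hab. lra. }
  apply Rabs_le. split.
  - assert (picard_step G t0 y0 z t - picard_step G t0 y0 y t <= E t).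
    { apply Hone; auto. intros r Hr. rewrite Rabs_minus_sym. auto. }
    unfold E in *. lra.
  - apply Hone; auto.
Qed.

Lemma geometric_limit (u : nat -> R) (C : R) :
  (forall n, Rabs (u (S n) - u n) <= C * (/ 2) ^ n) ->
  exists l : R, is_lim_seq u l /\ forall n, Rabs (u n - l) <= 2 * C * (/ 2) ^ n.
Proof.
  intros H.
  assert (Hp : forall n, 0 < (/ 2) ^ n) by (intros; apply pow_lt; lra).
  assert (HC : 0 <= C).
  { pose proof (H O). pose proof (Rabs_pos (u 1%nat - u 0%nat)). simpl in *. lra. }
  assert (Hk : forall n k, Rabs (u (n + k)%nat - u n) <= 2 * C * (/ 2) ^ n - 2 * C * (/ 2) ^ (n + k)).
  { intros n k. induction k.
    - rewrite Nat.add_0_r. rewrite Rminus_diag, Rabs_R0. lra.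
    - rewrite Nat.add_succ_r.
      replace (u (S (n + k)) - u n) with
        ((u (S (n + k)) - u (n + k)%nat) + (u (n + k)%nat - u n)) by ring.
      apply Rle_trans with (1 := Rabs_triang _ _).
      pose proof (H (n + k)%nat). simpl. lra. }
  assert (Hc : ex_finite_lim_seq u).
  { apply ex_lim_seq_cauchy_corr. intros eps.
    destruct (pow_lt_1_zero (/ 2)) with (y := eps / (4 * C + 1)) as [N HN].
    - rewrite Rabs_right; lra.
    - apply Rdiv_lt_0_compat; [apply cond_pos|lra].
    - exists N. intros n m Hn Hm.
      specialize (HN N (le_n _)). rewrite Rabs_right in HN.
      2: pose proof (Hp N); lra.
      apply Rmult_lt_compat_l with (r := 4 * C + 1) in HN; [|lra].
      replace ((4 * C + 1) * (eps / (4 * C + 1))) with (pos eps) in HN by (field; lra).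
      pose proof (Hk N (n - N)%nat) as A1. pose proof (Hk N (m - N)%nat) as A2.
      replace (N + (n - N))%nat with n in A1 by lia.
      replace (N + (m - N))%nat with m in A2 by lia.
      replace (u n - u m) with ((u n - u N) + - (u m - u N)) by ring.
      apply Rle_lt_trans with (1 := Rabs_triang _ _). rewrite Rabs_Ropp.
      pose proof (Rmult_le_pos _ _ HC (Rlt_le _ _ (Hp n))).
      pose proof (Rmult_le_pos _ _ HC (Rlt_le _ _ (Hp m))).
      pose proof (Hp N). lra. }
  destruct Hc as [l Hl]. exists l. split; [exact Hl|]. intros n.
  rewrite Rabs_minus_sym.
  assert (Hl' : is_lim_seq (fun k => Rabs (u (k + n)%nat - u n)) (Rabs (l - u n))).
  { apply (is_lim_seq_abs _ (Finite (l - u n))).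
    apply (is_lim_seq_minus' (fun k => u (k + n)%nat) (fun _ => u n)).
    - apply -> (is_lim_seq_incr_n u n l). exact Hl.
    - apply is_lim_seq_const. }
  apply (is_lim_seq_le (fun k => Rabs (u (k + n)%nat - u n)) (fun _ => 2 * C * (/ 2) ^ n)
    (Rabs (l - u n)) (2 * C * (/ 2) ^ n)); auto.
  - intros k. rewrite Nat.add_comm. pose proof (Hk n k).
    pose proof (Rmult_le_pos _ _ HC (Rlt_le _ _ (Hp (n + k)%nat))). lra.
  - apply is_lim_seq_const.
Qed.

Lemma picard_iter_dist G B L t0 y0 n t :
  lipschitz_field G B L -> 0 < L -> t0 <= t ->
  Rabs (picard_iter G t0 y0 (S n) t - picard_iter G t0 y0 n t)
    <= (B / (2 * L) * exp (2 * L * (t - t0))) * (/ 2) ^ n.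
Proof.
  intros HG HL.
  assert (HB := field_bound_nonneg _ _ _ HG).
  assert (HK : 0 <= B / (2 * L)) by (apply Rdiv_le_0_compat; lra).
  revert t. induction n; intros t Ht.
  - rewrite pow_O, Rmult_1_r.
    change (Rabs (picard_step G t0 y0 (fun _ => y0) t - y0) <= B / (2 * L) * exp (2 * L * (t - t0))).
    rewrite <- (picard_step_before G t0 y0 (fun _ => y0) t0) at 2 by lra.
    apply Rle_trans with (B * Rabs (t - t0)).
    { eapply picard_step_lipschitz; eauto. intros; apply continuous_const. }
    rewrite Rabs_right by lra.
    (* The first step is at most B (t - t0), and x <= exp x. *)
    replace (B * (t - t0)) with (B / (2 * L) * (2 * L * (t - t0))) by (field; lra).
    apply Rmult_le_compat_l; [lra|].
    pose proof (exp_ineq1_le (2 * L * (t - t0))). lra.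
  - replace (B / (2 * L) * exp (2 * L * (t - t0)) * (/ 2) ^ S n)
      with ((B / (2 * L) * (/ 2) ^ n) / 2 * exp (2 * L * (t - t0))) by (simpl; field; lra).
    apply (picard_step_contraction G B L t0 y0 (picard_iter G t0 y0 (S n)) (picard_iter G t0 y0 n)); auto.
    + apply Rmult_le_pos; [lra|]. apply pow_le; lra.
    + intros r. apply (picard_iter_continuous G B L t0 y0 (S n) r HG).
    + intros r. apply (picard_iter_continuous G B L t0 y0 n r HG).
    + intros r Hr. specialize (IHn r Hr). lra.
Qed.

Lemma picard_iter_before G t0 y0 n t : t <= t0 -> picard_iter G t0 y0 n t = y0.
Proof. intros H. destruct n; [reflexivity|apply picard_step_before, H]. Qed.

Lemma picard_limit G B L t0 y0 t :
  lipschitz_field G B L -> 0 < L ->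
  is_lim_seq (fun n => picard_iter G t0 y0 n t) (picard G t0 y0 t) /\
  forall n, t0 <= t -> Rabs (picard_iter G t0 y0 n t - picard G t0 y0 t)
      <= 2 * (B / (2 * L) * exp (2 * L * (t - t0))) * (/ 2) ^ n.
Proof.
  intros HG HL. unfold picard.
  destruct (Rle_or_lt t0 t) as [Ht|Ht].
  - destruct (geometric_limit (fun n => picard_iter G t0 y0 n t)
      (B / (2 * L) * exp (2 * L * (t - t0)))) as [l [Hl Hd]].
    + intros n. apply picard_iter_dist; auto.
    + rewrite (is_lim_seq_unique _ _ Hl). auto.
  - assert (Hl : is_lim_seq (fun n => picard_iter G t0 y0 n t) y0).
    { apply is_lim_seq_ext with (fun _ => y0); [|apply is_lim_seq_const].
      intros n. rewrite picard_iter_before; auto; lra. }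
    rewrite (is_lim_seq_unique _ _ Hl). split; [exact Hl|]. intros; lra.
Qed.

Lemma picard_before G t0 y0 t : t <= t0 -> picard G t0 y0 t = y0.
Proof.
  intros H. unfold picard.
  rewrite (Lim_seq_ext _ (fun _ => y0)), Lim_seq_const; [reflexivity|].
  intros n. apply picard_iter_before, H.
Qed.

Lemma picard_continuous G B L t0 y0 t :
  lipschitz_field G B L -> 0 < L -> continuous (picard G t0 y0) t.
Proof.
  intros HG HL. apply (lipschitz_continuous _ B). intros s.
  apply (is_lim_seq_le
    (fun n => Rabs (picard_iter G t0 y0 (S n) s - picard_iter G t0 y0 (S n) t))
    (fun _ => B * Rabs (s - t))
    (Rabs (picard G t0 y0 s - picard G t0 y0 t)) (B * Rabs (s - t))).
  - intros n. eapply picard_step_lipschitz; eauto.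
    intros r. eapply picard_iter_continuous; eauto.
  - apply (is_lim_seq_abs _ (Finite (picard G t0 y0 s - picard G t0 y0 t))).
    apply (is_lim_seq_minus' (fun n => picard_iter G t0 y0 (S n) s)
                             (fun n => picard_iter G t0 y0 (S n) t)).
    + apply (is_lim_seq_incr_1 (fun n => picard_iter G t0 y0 n s)).
      eapply picard_limit; eauto.
    + apply (is_lim_seq_incr_1 (fun n => picard_iter G t0 y0 n t)).
      eapply picard_limit; eauto.
  - apply is_lim_seq_const.
Qed.

(** The iterates converge to the limit at a geometric rate in the weighted norm,
    hence so do their images, which are again the iterates. *)
Lemma picard_fixed_point G B L t0 y0 t :
  lipschitz_field G B L -> 0 < L ->
  picard_step G t0 y0 (picard G t0 y0) t = picard G t0 y0 t.
Proof.
  intros HG HL.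
  destruct (Rle_or_lt t0 t) as [Ht|Ht].
  2: { rewrite picard_step_before, picard_before; auto; lra. }
  destruct (picard_limit G B L t0 y0 t HG HL) as [Hl _].
  assert (HB := field_bound_nonneg _ _ _ HG).
  assert (HK : 0 <= B / (2 * L)) by (apply Rdiv_le_0_compat; lra).
  assert (Hl2 : is_lim_seq (fun n => picard_iter G t0 y0 (S n) t)
            (picard_step G t0 y0 (picard G t0 y0) t)).
  { apply is_lim_seq_spec.
    set (C := B / (2 * L) * exp (2 * L * (t - t0))).
    assert (HC : 0 <= C) by (apply Rmult_le_pos; [lra|apply Rlt_le, exp_pos]).
    intros eps.
    destruct (pow_lt_1_zero (/ 2)) with (y := eps / (C + 1)) as [N HN].
    - rewrite Rabs_right; lra.
    - apply Rdiv_lt_0_compat; [apply cond_pos|lra].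
    - exists N. intros n Hn. specialize (HN n Hn).
      assert (Hp : 0 < (/ 2) ^ n) by (apply pow_lt; lra).
      rewrite Rabs_right in HN by lra.
      apply Rmult_lt_compat_l with (r := C + 1) in HN; [|lra].
      replace ((C + 1) * (eps / (C + 1))) with (pos eps) in HN by (field; lra).
      apply Rle_lt_trans with (C * (/ 2) ^ n); [|nra].
      replace (C * (/ 2) ^ n) with
        ((2 * (B / (2 * L)) * (/ 2) ^ n) / 2 * exp (2 * L * (t - t0)))
        by (unfold C; field; lra).
      apply (picard_step_contraction G B L t0 y0 (picard_iter G t0 y0 n) (picard G t0 y0)); auto.
      + apply Rmult_le_pos; lra.
      + intros r. eapply picard_iter_continuous; eauto.
      + intros r. eapply picard_continuous; eauto.
      + intros r Hr. destruct (picard_limit G B L t0 y0 r HG HL) as [_ Hd].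
        specialize (Hd n Hr). lra. }
  apply is_lim_seq_unique in Hl2.
  apply (is_lim_seq_incr_1 (fun n => picard_iter G t0 y0 n t)) in Hl.
  apply is_lim_seq_unique in Hl. rewrite Hl in Hl2. injection Hl2. auto.
Qed.

Lemma picard_derive G B L t0 y0 t :
  lipschitz_field G B L -> 0 < L -> t0 < t ->
  is_derive (picard G t0 y0) t (G t (picard G t0 y0 t)).
Proof.
  intros HG HL Ht.
  apply (is_derive_ext (picard_step G t0 y0 (picard G t0 y0))).
  - intros x. eapply picard_fixed_point; eauto.
  - eapply picard_step_derive; eauto. intros r. eapply picard_continuous; eauto.
Qed.

(** * The singular nonlinearity and its truncations *)

(** With w = sqrt (y (2 - y)) this is (1 - y) / w, the reciprocal of the
    nonlinearity of the equation for y. *)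
Definition phi (w : R) : R := sqrt (1 - w ^ 2) / w.

Lemma phi_nonneg x : 0 < x -> 0 <= phi x.
Proof. intros H. apply Rdiv_le_0_compat; [apply sqrt_pos|exact H]. Qed.

Lemma phi_decreasing x y : 0 < x -> x <= y -> phi y <= phi x.
Proof.
  intros Hx Hxy. unfold phi, Rdiv. apply Rmult_le_compat.
  - apply sqrt_pos.
  - apply Rlt_le, Rinv_0_lt_compat. lra.
  - apply sqrt_le_1_alt. nra.
  - apply Rinv_le_contravar; lra.
Qed.

Lemma phi_le_inv x : 0 < x -> phi x <= / x.
Proof.
  intros H. unfold phi, Rdiv. rewrite <- (Rmult_1_l (/ x)) at 2.
  apply Rmult_le_compat_r; [apply Rlt_le, Rinv_0_lt_compat, H|].
  rewrite <- sqrt_1 at 2. apply sqrt_le_1_alt. nra.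
Qed.

Lemma phi_ge x : 0 < x <= / 2 -> / (2 * x) <= phi x.
Proof.
  intros H. unfold phi. replace (/ (2 * x)) with (/ 2 / x) by (field; lra).
  apply Rmult_le_compat_r; [apply Rlt_le, Rinv_0_lt_compat; lra|].
  rewrite <- (sqrt_pow2 (/ 2)) by lra. apply sqrt_le_1_alt. nra.
Qed.

Lemma phi_derive x : 0 < x < 1 -> is_derive phi x (- / (x ^ 2 * sqrt (1 - x ^ 2))).
Proof.
  intros H. assert (Hp : 0 < 1 - x ^ 2) by nra.
  assert (Hs : 0 < sqrt (1 - x ^ 2)) by (apply sqrt_lt_R0; exact Hp).
  assert (Hq : sqrt (1 - x ^ 2) * sqrt (1 - x ^ 2) = 1 - x ^ 2) by (apply sqrt_sqrt; lra).
  unfold phi. auto_derive.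
  - repeat split; lra.
  - replace (1 + - (x * (x * 1))) with (1 - x ^ 2) by ring.
    set (s := sqrt (1 - x ^ 2)) in *.
    field_simplify; [|lra|lra].
    replace (-2 * x ^ 2 - 2 * s ^ 2) with (-2) by (simpl; nra).
    field. lra.
Qed.

Lemma phi_lipschitz e M x y : 0 < e -> M < 1 -> e <= x <= M -> e <= y <= M ->
  Rabs (phi x - phi y) <= / (e ^ 2 * sqrt (1 - M ^ 2)) * Rabs (x - y).
Proof.
  intros He HM.
  assert (Hlt : forall a b, e <= a -> a < b -> b <= M ->
    phi a - phi b <= / (e ^ 2 * sqrt (1 - M ^ 2)) * (b - a)).
  { intros a b Ha Hab Hb.
    destruct (mean_value phi (fun r => - / (r ^ 2 * sqrt (1 - r ^ 2))) a b Hab) as [r [Hr E]].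
    - intros r Hr. eapply is_derive_continuous. apply phi_derive. lra.
    - intros r Hr. apply phi_derive. lra.
    - replace (phi a - phi b) with (/ (r ^ 2 * sqrt (1 - r ^ 2)) * (b - a)) by lra.
      apply Rmult_le_compat_r; [lra|]. apply Rinv_le_contravar.
      + apply Rmult_lt_0_compat; [nra|]. apply sqrt_lt_R0. nra.
      + apply Rmult_le_compat; [nra|apply sqrt_pos|nra|]. apply sqrt_le_1_alt. nra. }
  intros Hx Hy. destruct (Rtotal_order x y) as [H|[H|H]].
  - rewrite Rabs_right. 2: pose proof (phi_decreasing x y); lra.
    rewrite Rabs_left by lra. replace (- (x - y)) with (y - x) by ring. apply Hlt; lra.
  - rewrite H, !Rminus_diag, Rabs_R0. lra.
  - rewrite Rabs_minus_sym, (Rabs_right (x - y)) by lra. rewrite Rabs_right.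
    2: pose proof (phi_decreasing y x); lra. apply Hlt; lra.
Qed.

Definition cut (lo hi x : R) : R := Rmax lo (Rmin hi x).

Lemma cut_bounds lo hi x : lo <= hi -> lo <= cut lo hi x <= hi.
Proof. intros H. unfold cut, Rmax, Rmin. destruct (Rle_dec hi x), (Rle_dec lo _); lra. Qed.

Lemma cut_id lo hi x : lo <= x <= hi -> cut lo hi x = x.
Proof. intros H. unfold cut. rewrite Rmin_right, Rmax_right; lra. Qed.

Lemma cut_nonexpansive lo hi x y : Rabs (cut lo hi x - cut lo hi y) <= 1 * Rabs (x - y).
Proof.
  rewrite Rmult_1_l. unfold cut. eapply Rle_trans; [apply Rmax_nonexpansive|].
  apply Rmin_nonexpansive.
Qed.

Lemma cut_continuous lo hi x : continuous (cut lo hi) x.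
Proof. apply (lipschitz_continuous _ 1). intros y. apply cut_nonexpansive. Qed.

(** Values of [x] outside the interval [M / (n + 1), M] are moved to its nearest
    end, which removes both the pole at 0 and the infinite slope at 1; the level M /
    (n + 1) never exceeds M, so that no [n] is exceptional. *)
Definition phi_cut (M : R) (n : nat) (x : R) : R := phi (cut (M / (INR n + 1)) M x).

Lemma level_bounds M n : 0 < M -> 0 < M / (INR n + 1) <= M.
Proof.
  intros H. pose proof (pos_INR n). split.
  - apply Rdiv_lt_0_compat; lra.
  - apply Rmult_le_reg_r with (INR n + 1); [lra|]. unfold Rdiv.
    rewrite Rmult_assoc, Rinv_l by lra. nra.
Qed.

Lemma level_decreasing M n m : 0 < M -> (n <= m)%nat -> M / (INR m + 1) <= M / (INR n + 1).
Proof.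
  intros H Hnm. apply le_INR in Hnm. pose proof (pos_INR n).
  apply Rmult_le_compat_l; [lra|]. apply Rinv_le_contravar; lra.
Qed.

Lemma level_small M k : 0 < k -> exists N, forall n, (N <= n)%nat -> M / (INR n + 1) <= k.
Proof.
  intros Hk. destruct (INR_unbounded (M / k)) as [N HN].
  exists N. intros n Hn. apply le_INR in Hn. pose proof (pos_INR n).
  apply Rmult_le_reg_r with (INR n + 1); [lra|].
  unfold Rdiv at 1. rewrite Rmult_assoc, Rinv_l by lra.
  assert (M / k * k < INR N * k) by (apply Rmult_lt_compat_r; lra).
  replace (M / k * k) with M in * by (field; lra). nra.
Qed.

Lemma phi_cut_nonneg M n x : 0 < M -> 0 <= phi_cut M n x.
Proof.
  intros H. pose proof (level_bounds M n H). apply phi_nonneg.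
  pose proof (cut_bounds (M / (INR n + 1)) M x). lra.
Qed.

Lemma phi_cut_decreasing M n x y : 0 < M -> x <= y -> phi_cut M n y <= phi_cut M n x.
Proof.
  intros H Hxy. pose proof (level_bounds M n H). apply phi_decreasing.
  - pose proof (cut_bounds (M / (INR n + 1)) M x). lra.
  - unfold cut. apply Rle_max_compat_l, Rle_min_compat_l, Hxy.
Qed.

Lemma phi_cut_increasing_n M n m x : 0 < M -> (n <= m)%nat -> phi_cut M n x <= phi_cut M m x.
Proof.
  intros H Hnm. pose proof (level_bounds M m H). apply phi_decreasing.
  - pose proof (cut_bounds (M / (INR m + 1)) M x). lra.
  - unfold cut. apply Rle_max_compat_r, level_decreasing; auto.
Qed.

Lemma phi_cut_exact M n x : M / (INR n + 1) <= x -> 0 < M -> phi_cut M n x = phi (Rmin M x).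
Proof.
  intros H HM. unfold phi_cut, cut. rewrite Rmax_right; [reflexivity|].
  pose proof (level_bounds M n HM). apply Rmin_glb; lra.
Qed.

Lemma phi_cut_le_phi M n x : 0 < x <= M -> phi_cut M n x <= phi x.
Proof.
  intros H. apply phi_decreasing; [lra|]. unfold cut. rewrite Rmin_right by lra. apply Rmax_r.
Qed.

Lemma phi_cut_bounded M n x : 0 < M -> phi_cut M n x <= phi (M / (INR n + 1)).
Proof.
  intros H. pose proof (level_bounds M n H). apply phi_decreasing; [lra|apply Rmax_l].
Qed.

Lemma phi_cut_lipschitz M n x y : 0 < M < 1 ->
  Rabs (phi_cut M n x - phi_cut M n y)
    <= / ((M / (INR n + 1)) ^ 2 * sqrt (1 - M ^ 2)) * Rabs (x - y).
Proof.
  intros H. pose proof (level_bounds M n (proj1 H)) as He.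
  eapply Rle_trans. apply (phi_lipschitz (M / (INR n + 1)) M); try lra;
  apply cut_bounds; lra.
  apply Rmult_le_compat_l.
  - apply Rlt_le, Rinv_0_lt_compat, Rmult_lt_0_compat; [nra|]. apply sqrt_lt_R0; nra.
  - rewrite <- (Rmult_1_l (Rabs (x - y))). apply cut_nonexpansive.
Qed.

(** * Truncated problems *)

(** The names come from w' = a(t) + p(t) phi(w): [a] drives w whatever its value,
    [p] pushes it away from 0. *)
Record coefficients (a p : R -> R) (A P : R) : Prop := {
  drift_continuous : forall t, continuous a t;
  drift_bounded : forall t, Rabs (a t) <= A;
  force_continuous : forall t, continuous p t;
  force_bounded : forall t, 0 <= p t <= P }.

Definition reg_field (a p : R -> R) (M : R) (n : nat) (s x : R) : R :=
  a s + p s * phi_cut M n x.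

(** The added 1 keeps the constant positive when the force vanishes identically, as
    the Picard estimates divide by it. *)
Definition reg_lip (P M : R) (n : nat) : R :=
  P * / ((M / (INR n + 1)) ^ 2 * sqrt (1 - M ^ 2)) + 1.

Lemma reg_lip_pos P M n : 0 <= P -> 0 < M < 1 -> 0 < reg_lip P M n.
Proof.
  intros HP HM. unfold reg_lip. apply Rplus_le_lt_0_compat; [|lra].
  apply Rmult_le_pos; [exact HP|].
  pose proof (level_bounds M n (proj1 HM)).
  apply Rlt_le, Rinv_0_lt_compat, Rmult_lt_0_compat; [nra|]. apply sqrt_lt_R0; nra.
Qed.

Lemma reg_field_lipschitz a p A P M n : coefficients a p A P -> 0 < M < 1 ->
  lipschitz_field (reg_field a p M n)
    (A + P * phi (M / (INR n + 1))) (reg_lip P M n).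
Proof.
  intros Hc HM. split.
  - intros y Hy t. unfold reg_field.
    apply (continuous_plus a (fun s => p s * phi_cut M n (y s))).
    + apply (drift_continuous _ _ _ _ Hc).
    + apply (continuous_mult p (fun s => phi_cut M n (y s))).
      * apply (force_continuous _ _ _ _ Hc).
      * apply (continuous_comp y (phi_cut M n)); [apply Hy|].
        eapply lipschitz_continuous. intros z. apply phi_cut_lipschitz, HM.
  - intros s x. unfold reg_field. eapply Rle_trans; [apply Rabs_triang|].
    apply Rplus_le_compat; [apply (drift_bounded _ _ _ _ Hc)|].
    pose proof (force_bounded _ _ _ _ Hc s).
    pose proof (phi_cut_nonneg M n x (proj1 HM)).
    rewrite Rabs_right by nra.
    apply Rmult_le_compat; try lra. apply phi_cut_bounded, HM.
  - intros s x y. unfold reg_field, reg_lip.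
    replace (a s + p s * phi_cut M n x - (a s + p s * phi_cut M n y))
      with (p s * (phi_cut M n x - phi_cut M n y)) by ring.
    pose proof (force_bounded _ _ _ _ Hc s).
    rewrite Rabs_mult, (Rabs_right (p s)) by lra.
    pose proof (phi_cut_lipschitz M n x y HM).
    pose proof (Rabs_pos (x - y)). pose proof (Rabs_pos (phi_cut M n x - phi_cut M n y)).
    apply Rle_trans with (P * Rabs (phi_cut M n x - phi_cut M n y)).
    { apply Rmult_le_compat_r; lra. }
    apply Rle_trans with (P * (/ ((M / (INR n + 1)) ^ 2 * sqrt (1 - M ^ 2)) * Rabs (x - y))).
    { apply Rmult_le_compat_l; lra. }
    lra.
Qed.

Lemma force_sup_nonneg a p A P : coefficients a p A P -> 0 <= P.
Proof. intros Hc. pose proof (force_bounded _ _ _ _ Hc 0). lra. Qed.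

Lemma drift_sup_nonneg a p A P : coefficients a p A P -> 0 <= A.
Proof.
  intros Hc. pose proof (drift_bounded _ _ _ _ Hc 0). pose proof (Rabs_pos (a 0)). lra.
Qed.

Definition reg_sol (a p : R -> R) (M : R) (n : nat) : R -> R :=
  picard (reg_field a p M n) 0 0.

Section Regularized.
Variables (a p : R -> R) (A P M : R).
Hypothesis Hc : coefficients a p A P.
Hypothesis HM : 0 < M < 1.

Lemma reg_sol_continuous n t : continuous (reg_sol a p M n) t.
Proof.
  eapply picard_continuous. eapply reg_field_lipschitz; eauto.
  apply reg_lip_pos; auto. eapply force_sup_nonneg; eauto.
Qed.

Lemma reg_sol_before n t : t <= 0 -> reg_sol a p M n t = 0.
Proof. apply picard_before. Qed.

Lemma reg_sol_derive n t : 0 < t ->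
  is_derive (reg_sol a p M n) t (a t + p t * phi_cut M n (reg_sol a p M n t)).
Proof.
  eapply picard_derive. eapply reg_field_lipschitz; eauto.
  apply reg_lip_pos; auto. eapply force_sup_nonneg; eauto.
Qed.

(** Since the truncated nonlinearity decreases, it suffices to test the differential
    inequality along the barrier [b] itself. *)
Lemma reg_sol_below n b b' s t :
  0 <= s <= t ->
  (forall r, s <= r <= t -> continuous b r) ->
  (forall r, s < r < t -> is_derive b r (b' r)) ->
  reg_sol a p M n s <= b s ->
  (forall r, s < r < t -> a r + p r * phi_cut M n (b r) <= b' r) ->
  reg_sol a p M n t <= b t.
Proof.
  intros Hst Cb Db H0 H.
  apply (comparison (reg_sol a p M n) b
    (fun r => a r + p r * phi_cut M n (reg_sol a p M n r)) b' s t); auto.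
  - lra.
  - intros; apply reg_sol_continuous.
  - intros; apply reg_sol_derive; lra.
  - intros r Hr Hlt. eapply Rle_trans; [|apply H, Hr].
    apply Rplus_le_compat_l, Rmult_le_compat_l.
    + apply (force_bounded _ _ _ _ Hc).
    + apply phi_cut_decreasing; lra.
Qed.

Lemma reg_sol_above n b b' s t :
  0 <= s <= t ->
  (forall r, s <= r <= t -> continuous b r) ->
  (forall r, s < r < t -> is_derive b r (b' r)) ->
  b s <= reg_sol a p M n s ->
  (forall r, s < r < t -> b' r <= a r + p r * phi_cut M n (b r)) ->
  b t <= reg_sol a p M n t.
Proof.
  intros Hst Cb Db H0 H.
  apply (comparison b (reg_sol a p M n) b'
    (fun r => a r + p r * phi_cut M n (reg_sol a p M n r)) s t); auto.
  - lra.
  - intros; apply reg_sol_continuous.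
  - intros; apply reg_sol_derive; lra.
  - intros r Hr Hlt. eapply Rle_trans; [apply H, Hr|].
    apply Rplus_le_compat_l, Rmult_le_compat_l.
    + apply (force_bounded _ _ _ _ Hc).
    + apply phi_cut_decreasing; lra.
Qed.

(** The force is nonnegative, so that a solution grows at least like any primitive
    of a minorant of the drift. *)
Lemma reg_sol_gain n J j s t : 0 <= s <= t ->
  (forall r, s <= r <= t -> continuous J r) ->
  (forall r, s < r < t -> is_derive J r (j r)) ->
  (forall r, s < r < t -> j r <= a r) ->
  reg_sol a p M n s + (J t - J s) <= reg_sol a p M n t.
Proof.
  intros Hst CJ DJ HJ.
  apply (reg_sol_above n (fun r => reg_sol a p M n s + (J r - J s)) j s t); auto.
  - intros r Hr. apply (continuous_plus (fun _ => reg_sol a p M n s) (fun r => J r - J s)).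
    + apply continuous_const.
    + apply (continuous_minus J (fun _ => J s)); [auto|apply continuous_const].
  - intros r Hr. specialize (DJ r Hr). auto_derive.
    + exists (j r); exact DJ.
    + replace (Derive (fun x : R => J x) r) with (j r) by (symmetry; apply is_derive_unique, DJ). ring.
  - lra.
  - intros r Hr. specialize (HJ r Hr).
    pose proof (Rmult_le_pos _ _ (proj1 (force_bounded _ _ _ _ Hc r))
      (phi_cut_nonneg M n (reg_sol a p M n s + (J r - J s)) (proj1 HM))). lra.
Qed.

(** Truncating at a lower level raises the force term. *)
Lemma reg_sol_increasing n m t : (n <= m)%nat -> reg_sol a p M n t <= reg_sol a p M m t.
Proof.
  intros Hnm. destruct (Rle_or_lt t 0) as [Ht|Ht].
  - rewrite !reg_sol_before; lra.
  - apply (reg_sol_below n _ (fun r => a r + p r * phi_cut M m (reg_sol a p M m r)) 0 t).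
    + lra.
    + intros; apply reg_sol_continuous.
    + intros; apply reg_sol_derive; lra.
    + rewrite !reg_sol_before; lra.
    + intros r _. apply Rplus_le_compat_l, Rmult_le_compat_l.
      * apply (force_bounded _ _ _ _ Hc).
      * apply phi_cut_increasing_n; [lra|exact Hnm].
Qed.

(** Above the cap the force term is constant, so that growth is at most linear,
    uniformly in [n]. *)
Lemma reg_sol_bounded n t : 0 <= t ->
  reg_sol a p M n t <= M + (A + P * phi M) * (t - 0).
Proof.
  intros Ht.
  assert (HA := drift_sup_nonneg _ _ _ _ Hc).
  pose proof (force_sup_nonneg _ _ _ _ Hc) as HP. pose proof (phi_nonneg M (proj1 HM)) as Hphi.
  pose proof (Rmult_le_pos _ _ HP Hphi).
  apply (reg_sol_below n (fun r => M + (A + P * phi M) * (r - 0)) (fun _ => A + P * phi M) 0 t).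
  - lra.
  - intros; apply continuous_affine.
  - intros; apply is_derive_affine.
  - rewrite reg_sol_before; lra.
  - intros r Hr.
    assert (Hb : M <= M + (A + P * phi M) * (r - 0)) by nra.
    rewrite phi_cut_exact, Rmin_left; try lra.
    2: pose proof (level_bounds M n (proj1 HM)); lra.
    pose proof (force_bounded _ _ _ _ Hc r).
    pose proof (drift_bounded _ _ _ _ Hc r). pose proof (Rle_abs (a r)).
    assert (p r * phi M <= P * phi M) by (apply Rmult_le_compat_r; lra). lra.
Qed.
End Regularized.

(** * The singular initial value problem *)

(** As the increasing limit of the truncated solutions it is defined for all times
    and all speeds, even where it is not positive and phi makes no sense; so it can
    be varied with the speed before positivity is known. *)
Definition sing_sol (a p : R -> R) (M t : R) : R :=
  real (Lim_seq (fun n => reg_sol a p M n t)).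

Section Singular.
Variables (a p : R -> R) (A P M : R).
Hypothesis Hc : coefficients a p A P.
Hypothesis HM : 0 < M < 1.

Lemma sing_sol_lim t : is_lim_seq (fun n => reg_sol a p M n t) (sing_sol a p M t).
Proof.
  apply Lim_seq_correct'. destruct (Rle_or_lt t 0) as [Ht|Ht].
  - exists 0. apply is_lim_seq_ext with (fun _ => 0); [|apply is_lim_seq_const].
    intros n. rewrite reg_sol_before; lra.
  - apply ex_finite_lim_seq_incr with (M + (A + P * phi M) * (t - 0)).
    + intros n. eapply reg_sol_increasing; eauto.
    + intros n. eapply reg_sol_bounded; eauto. lra.
Qed.

Lemma reg_sol_le_sing n t : reg_sol a p M n t <= sing_sol a p M t.
Proof.
  apply (is_lim_seq_incr_compare (fun n => reg_sol a p M n t)).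
  - apply sing_sol_lim.
  - intros k. eapply reg_sol_increasing; eauto.
Qed.

Lemma sing_sol_le t b : (forall n, reg_sol a p M n t <= b) -> sing_sol a p M t <= b.
Proof.
  intros H. apply (is_lim_seq_le (fun n => reg_sol a p M n t) (fun _ => b) (sing_sol a p M t) b); auto.
  - apply sing_sol_lim.
  - apply is_lim_seq_const.
Qed.

Lemma sing_sol_before t : t <= 0 -> sing_sol a p M t = 0.
Proof.
  intros Ht. unfold sing_sol. rewrite (Lim_seq_ext _ (fun _ => 0)), Lim_seq_const; auto.
  intros n. apply reg_sol_before, Ht.
Qed.

Lemma sing_sol_gain J j s t : 0 <= s <= t ->
  (forall r, s <= r <= t -> continuous J r) ->
  (forall r, s < r < t -> is_derive J r (j r)) ->
  (forall r, s < r < t -> j r <= a r) ->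
  sing_sol a p M s + (J t - J s) <= sing_sol a p M t.
Proof.
  intros Hst CJ DJ HJ.
  assert (sing_sol a p M s <= sing_sol a p M t - (J t - J s)); [|lra].
  apply sing_sol_le. intros n.
  pose proof (reg_sol_gain _ _ _ _ _ Hc HM n J j s t Hst CJ DJ HJ).
  pose proof (reg_sol_le_sing n t). lra.
Qed.

Lemma sing_sol_growth K s t : 0 <= s <= t -> (forall r, s < r < t -> K <= a r) ->
  sing_sol a p M s + K * (t - s) <= sing_sol a p M t.
Proof.
  intros Hst HK.
  replace (K * (t - s)) with ((0 + K * (t - s)) - (0 + K * (s - s))) by ring.
  apply (sing_sol_gain (fun r => 0 + K * (r - s)) (fun _ => K)); auto.
  - intros; apply continuous_affine.
  - intros; apply is_derive_affine.
Qed.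

Lemma sing_sol_gt t b : b < sing_sol a p M t ->
  exists n, b < reg_sol a p M n t.
Proof.
  intros H. pose proof (sing_sol_lim t) as L. apply is_lim_seq_spec in L.
  assert (He : 0 < sing_sol a p M t - b) by lra.
  destruct (L (mkposreal _ He)) as [N HN]. exists N.
  specialize (HN N (le_n _)). simpl in HN. apply Rabs_def2 in HN. lra.
Qed.

(** The barrier solves b b' = C, and phi(b) <= 1 / b: near 0 a solution rises at
    most like a square root, because of the pole. *)
Lemma sing_sol_sqrt_bound C t : 0 <= t -> 0 < C ->
  (forall r, 0 < r < t -> a r + p r * / sqrt (2 * C * r) <= C * / sqrt (2 * C * r)) ->
  sqrt (2 * C * t) <= M -> sing_sol a p M t <= sqrt (2 * C * t).
Proof.
  intros Ht HC H HtM. apply sing_sol_le. intros n.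
  apply (reg_sol_below _ _ _ _ _ Hc HM n (fun r => sqrt (2 * C * r)) (fun r => C * / sqrt (2 * C * r)) 0 t).
  - lra.
  - intros r _. apply (continuous_comp (fun r => 2 * C * r) sqrt).
    + apply is_derive_continuous with (2 * C). auto_derive; [trivial|ring].
    + apply continuous_sqrt.
  - intros r Hr. assert (0 < 2 * C * r) by nra.
    assert (0 < sqrt (2 * C * r)) by (apply sqrt_lt_R0; lra).
    auto_derive; [lra|]. field. lra.
  - rewrite reg_sol_before by lra. apply sqrt_pos.
  - intros r Hr. eapply Rle_trans; [|apply H, Hr].
    assert (0 < 2 * C * r) by nra.
    assert (0 < sqrt (2 * C * r)) by (apply sqrt_lt_R0; lra).
    apply Rplus_le_compat_l, Rmult_le_compat_l; [apply (force_bounded _ _ _ _ Hc)|].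
    eapply Rle_trans; [|apply phi_le_inv; auto].
    apply phi_cut_le_phi. split; [auto|].
    eapply Rle_trans; [|apply HtM]. apply sqrt_le_1_alt. nra.
Qed.

Lemma sing_sol_continuous_0 : continuous (sing_sol a p M) 0.
Proof.
  assert (HA := drift_sup_nonneg _ _ _ _ Hc).
  pose proof (force_sup_nonneg _ _ _ _ Hc) as HP.
  set (C := A + P + 1).
  apply continuity_pt_filterlim. intros eps He.
  (* The square root bound holds up to level M only; e^2 / (2 C) is the time at
     which it reaches e. *)
  set (e := Rmin eps M).
  assert (He' : 0 < e) by (apply Rmin_glb_lt; lra).
  assert (e <= eps) by apply Rmin_l. assert (e <= M) by apply Rmin_r.
  assert (HC : 1 <= C) by (unfold C; lra).
  exists (e ^ 2 / (2 * C) / 2).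
  assert (Hd : 0 < e ^ 2 / (2 * C)) by (apply Rdiv_lt_0_compat; nra).
  split; [lra|]. intros t [_ Ht]. simpl in *. unfold R_dist in *.
  rewrite (sing_sol_before 0) by lra. rewrite Rminus_0_r in *.
  destruct (Rle_or_lt t 0) as [Hn|Hp].
  { rewrite sing_sol_before, Rabs_R0; lra. }
  apply Rabs_def2 in Ht.
  assert (Hsq : sqrt (2 * C * t) < e).
  { rewrite <- (sqrt_pow2 e) by lra. apply sqrt_lt_1_alt. split; [nra|].
    apply Rlt_le_trans with (2 * C * (e ^ 2 / (2 * C))); [apply Rmult_lt_compat_l; lra|].
    right. field. lra. }
  assert (Hup : sing_sol a p M t <= sqrt (2 * C * t)).
  { apply sing_sol_sqrt_bound; try lra. intros r Hr.
    assert (Hs : 0 < sqrt (2 * C * r)) by (apply sqrt_lt_R0; nra).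
    assert (Hs1 : sqrt (2 * C * r) <= 1).
    { apply Rle_trans with (sqrt (2 * C * t)); [|lra]. apply sqrt_le_1_alt. nra. }
    assert (Hi : 1 <= / sqrt (2 * C * r)).
    { rewrite <- Rinv_1. apply Rinv_le_contravar; lra. }
    pose proof (force_bounded _ _ _ _ Hc r).
    pose proof (drift_bounded _ _ _ _ Hc r). pose proof (Rle_abs (a r)).
    unfold C in *. set (q := / sqrt _) in *. nra. }
  assert (Hlo : sing_sol a p M 0 + - A * (t - 0) <= sing_sol a p M t).
  { apply sing_sol_growth; [lra|]. intros r _.
    pose proof (drift_bounded _ _ _ _ Hc r) as Hb. apply Rabs_le_between in Hb. lra. }
  rewrite sing_sol_before in Hlo by lra.
  apply Rabs_def1; [lra|].
  assert (e ^ 2 / (2 * C) / 2 <= e / (2 * C)).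
  { assert (e / (2 * C) > 0) by (apply Rdiv_lt_0_compat; lra).
    replace (e ^ 2 / (2 * C) / 2) with (e / (2 * C) * (e / 2)) by (field; lra).
    assert (e / 2 <= 1) by lra. nra. }
  assert (A * t <= C * t) by (apply Rmult_le_compat_r; unfold C; lra).
  assert (C * t < C * (e / (2 * C))) by (apply Rmult_lt_compat_l; lra).
  replace (C * (e / (2 * C))) with (e / 2) in * by (field; lra). lra.
Qed.

(** Where the force is positive, the pole repels strongly enough: from any value
    bounded below, a solution climbs to some fixed level [k] > 0 within a fixed
    time, for all sufficiently low truncations. *)
Lemma sing_sol_pos t : 0 < t -> 0 < p t -> 0 < sing_sol a p M t.
Proof.
  intros Ht Hp.
  assert (HA := drift_sup_nonneg _ _ _ _ Hc).
  destruct (continuous_pos_near p t (p t / 2) (force_continuous _ _ _ _ Hc t)) as [d [Hd Hn]]; [lra|].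
  set (s := t - Rmin t d / 2).
  assert (Hm : 0 < Rmin t d) by (apply Rmin_glb_lt; lra).
  pose proof (Rmin_l t d). pose proof (Rmin_r t d).
  assert (Hs : 0 < s < t) by (unfold s; lra).
  (* k is chosen so that below level k the force term exceeds Q; the net speed is
     then enough to climb from - A s to k between s and t. *)
  set (Q := A + (A * t + 1) / (t - s)).
  assert (HQ : 0 < (A * t + 1) / (t - s)) by (apply Rdiv_lt_0_compat; nra).
  set (k := Rmin M (Rmin (/ 2) (p t / (4 * Q)))).
  assert (HQ' : 0 < Q) by (unfold Q; lra).
  assert (Hk : 0 < k).
  { repeat apply Rmin_glb_lt; try lra. apply Rdiv_lt_0_compat; lra. }
  assert (Hk1 : k <= M) by apply Rmin_l.
  assert (Hk2 : k <= / 2) by (eapply Rle_trans; [apply Rmin_r|apply Rmin_l]).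
  assert (Hk3 : k <= p t / (4 * Q)) by (eapply Rle_trans; [apply Rmin_r|apply Rmin_r]).
  assert (Hphi : Q <= p t / 2 * phi k).
  { apply Rle_trans with (p t / 2 * / (2 * k)).
    - apply Rmult_le_reg_r with (4 * k); [lra|].
      replace (p t / 2 * / (2 * k) * (4 * k)) with (p t) by (field; lra).
      apply Rmult_le_compat_l with (r := 4 * Q) in Hk3; [|lra].
      replace (4 * Q * (p t / (4 * Q))) with (p t) in Hk3 by (field; lra). lra.
    - apply Rmult_le_compat_l; [lra|]. apply phi_ge. lra. }
  destruct (level_small M k Hk) as [n Hlev].
  specialize (Hlev n (le_n _)).
  set (K := (A * s + k) / (t - s)).
  apply Rlt_le_trans with k; [exact Hk|].
  apply Rle_trans with (reg_sol a p M n t); [|apply reg_sol_le_sing].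
  replace k with (- A * s + K * (t - s)) at 1 by (unfold K; field; lra).
  apply (reg_sol_above _ _ _ _ _ Hc HM n (fun r => - A * s + K * (r - s)) (fun _ => K) s t).
  - lra.
  - intros; apply continuous_affine.
  - intros; apply is_derive_affine.
  - pose proof (reg_sol_gain _ _ _ _ _ Hc HM n (fun r => 0 + - A * (r - 0)) (fun _ => - A) 0 s) as Hsl.
    rewrite reg_sol_before in Hsl by lra.
    assert (0 + (0 + - A * (s - 0) - (0 + - A * (0 - 0))) <= reg_sol a p M n s); [|lra].
    apply Hsl; [lra|intros; apply continuous_affine|intros; apply is_derive_affine|].
    intros r _.
    pose proof (drift_bounded _ _ _ _ Hc r) as Hb. apply Rabs_le_between in Hb. lra.
  - intros r Hr.
    assert (HK0 : 0 <= K) by (apply Rdiv_le_0_compat; nra).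
    assert (HKQ : K <= (A * t + 1) / (t - s)).
    { apply Rmult_le_compat_r; [apply Rlt_le, Rinv_0_lt_compat; lra|]. nra. }
    assert (Hbk : - A * s + K * (r - s) <= k).
    { apply Rle_trans with (- A * s + K * (t - s)).
      - apply Rplus_le_compat_l, Rmult_le_compat_l; lra.
      - right. unfold K. field. lra. }
    assert (Hcp : phi k <= phi_cut M n (- A * s + K * (r - s))).
    { apply Rle_trans with (phi_cut M n k); [|apply phi_cut_decreasing; lra].
      rewrite phi_cut_exact, Rmin_right; lra. }
    assert (Hpr : p t / 2 < p r).
    { apply Hn. apply Rabs_def1; unfold s in *; lra. }
    pose proof (drift_bounded _ _ _ _ Hc r) as Hb. apply Rabs_le_between in Hb.
    pose proof (phi_nonneg k Hk).
    unfold Q in *.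
    assert (p t / 2 * phi k <= p r * phi_cut M n (- A * s + K * (r - s)))
      by (apply Rmult_le_compat; lra).
    lra.
Qed.

(** Near a point where the limit is positive, the truncated solutions are eventually
    bounded below by a common [k] > 0, hence all solve one and the same Lipschitz
    equation there. Contraction then identifies their limit with the solution [v] of
    that equation. *)
Lemma sing_sol_derive t : 0 < t -> 0 < sing_sol a p M t ->
  is_derive (sing_sol a p M) t (a t + p t * phi (Rmin M (sing_sol a p M t))).
Proof.
  intros Ht Hpos.
  pose proof (force_sup_nonneg _ _ _ _ Hc) as HP.
  destruct (sing_sol_gt t 0 Hpos) as [N HN].
  set (k := reg_sol a p M N t / 2).
  destruct (continuous_pos_near (reg_sol a p M N) t k) as [d [Hd Hnear]].
  { eapply reg_sol_continuous; eauto. } { unfold k; lra. }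
  destruct (level_small M k) as [N1 HN1]; [unfold k; lra|].
  (* From index m on, the truncated solutions exceed k near t, and the truncation
     level lies below k. *)
  set (m := Nat.max N N1).
  set (s := t - Rmin t d / 2).
  assert (Hm : 0 < Rmin t d) by (apply Rmin_glb_lt; lra).
  pose proof (Rmin_l t d). pose proof (Rmin_r t d).
  assert (Hs : 0 < s < t) by (unfold s; lra).
  set (v := picard (reg_field a p M m) s (sing_sol a p M s)).
  pose proof (reg_field_lipschitz a p A P M m Hc HM) as Hlf.
  pose proof (reg_lip_pos P M m HP HM) as Hlp.
  assert (Cv : forall r, continuous v r) by (intros; eapply picard_continuous; eauto).
  assert (Dv : forall r, s < r -> is_derive v r (a r + p r * phi_cut M m (v r)))
    by (intros; apply (picard_derive _ _ _ _ _ _ Hlf Hlp); auto).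
  assert (Hv0 : v s = sing_sol a p M s) by (apply picard_before; lra).
  assert (Hlow : forall n r, (m <= n)%nat -> s <= r < t + d -> k < reg_sol a p M n r).
  { intros n r Hn Hr. apply Rlt_le_trans with (reg_sol a p M N r).
    - apply Hnear. apply Rabs_def1; unfold s in *; lra.
    - eapply reg_sol_increasing; eauto. lia. }
  assert (Hsame : forall n r, (m <= n)%nat -> s <= r < t + d ->
     phi_cut M n (reg_sol a p M n r) = phi_cut M m (reg_sol a p M n r)).
  { intros n r Hn Hr. pose proof (Hlow n r Hn Hr).
    rewrite !phi_cut_exact; auto; try lra.
    - apply Rle_trans with k; [apply HN1; lia|lra].
    - apply Rle_trans with k; [apply HN1; lia|lra]. }
  assert (Heq : forall r, s <= r < t + d -> sing_sol a p M r = v r).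
  { intros r Hr.
    assert (Hdist : forall n, (m <= n)%nat ->
       Rabs (reg_sol a p M n r - v r) <= sing_sol a p M s - reg_sol a p M n s).
    { intros n Hn.
      set (D := sing_sol a p M s - reg_sol a p M n s).
      assert (HD : 0 <= D) by (unfold D; pose proof (reg_sol_le_sing n s); lra).
      assert (H1 : reg_sol a p M n r <= v r).
      { apply (comparison (reg_sol a p M n) v
          (fun x => a x + p x * phi_cut M n (reg_sol a p M n x))
          (fun x => a x + p x * phi_cut M m (v x)) s r); auto; try lra.
        - intros; eapply reg_sol_continuous; eauto.
        - intros; eapply reg_sol_derive; eauto; lra.
        - intros; apply Dv; lra.
        - rewrite Hv0. apply reg_sol_le_sing.
        - intros x Hx Hlt. rewrite Hsame by (auto; lra).
          apply Rplus_le_compat_l, Rmult_le_compat_l; [apply (force_bounded _ _ _ _ Hc)|].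
          apply phi_cut_decreasing; lra. }
      assert (H2 : v r <= reg_sol a p M n r + D).
      { apply (comparison v (fun x => reg_sol a p M n x + D)
          (fun x => a x + p x * phi_cut M m (v x))
          (fun x => a x + p x * phi_cut M n (reg_sol a p M n x)) s r); auto; try lra.
        - intros. apply (continuous_plus (reg_sol a p M n) (fun _ => D)).
          eapply reg_sol_continuous; eauto. apply continuous_const.
        - intros; apply Dv; lra.
        - intros x Hx. rewrite <- (Rplus_0_r (a x + p x * phi_cut M n (reg_sol a p M n x))).
          apply (is_derive_plus (reg_sol a p M n) (fun _ => D)).
          eapply reg_sol_derive; eauto; lra. apply (is_derive_const D x).
        - rewrite Hv0. unfold D. lra.
        - intros x Hx Hlt. rewrite Hsame by (auto; lra).
          apply Rplus_le_compat_l, Rmult_le_compat_l; [apply (force_bounded _ _ _ _ Hc)|].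
          apply phi_cut_decreasing; lra. }
      rewrite Rabs_left1; lra. }
    assert (Hl : is_lim_seq (fun n => reg_sol a p M n r) (v r)).
    2: { apply is_lim_seq_unique in Hl. unfold sing_sol. rewrite Hl. reflexivity. }
    apply is_lim_seq_spec. intros eps.
    pose proof (sing_sol_lim s) as L. apply is_lim_seq_spec in L.
    destruct (L eps) as [N2 HN2]. exists (Nat.max m N2). intros n Hn.
    eapply Rle_lt_trans; [apply Hdist; lia|].
    specialize (HN2 n ltac:(lia)). apply Rabs_def2 in HN2. lra. }
  assert (Hvt : k <= sing_sol a p M t).
  { apply Rle_trans with (reg_sol a p M m t); [|apply reg_sol_le_sing].
    apply Rlt_le, Hlow; [lia|lra]. }
  assert (E : phi (Rmin M (sing_sol a p M t)) = phi_cut M m (v t)).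
  { rewrite <- Heq by lra. rewrite phi_cut_exact; auto; try lra.
    apply Rle_trans with k; [apply HN1; lia|lra]. }
  rewrite E.
  apply (is_derive_ext_loc v); [|apply Dv; lra].
  assert (Hr : 0 < Rmin t d / 2) by lra.
  exists (mkposreal _ Hr). intros x Hx. change (Rabs (x - t) < Rmin t d / 2) in Hx.
  apply Rabs_def2 in Hx. symmetry. apply Heq. unfold s; lra.
Qed.
End Singular.

(** Contraction in w: the force term only brings two solutions closer, so that a
    drift changed by at most [D] moves the solution by at most [D] times the elapsed
    time. *)
Lemma sing_sol_drift a1 a2 p A1 A2 P M D t :
  coefficients a1 p A1 P -> coefficients a2 p A2 P -> 0 < M < 1 ->
  (forall s, a1 s <= a2 s <= a1 s + D) -> 0 <= t ->
  sing_sol a1 p M t <= sing_sol a2 p M t <= sing_sol a1 p M t + D * t.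
Proof.
  intros H1 H2 HM Ha Ht.
  assert (HD : 0 <= D) by (pose proof (Ha 0); lra).
  split.
  - apply (sing_sol_le _ _ _ _ _ H1 HM). intros n.
    eapply Rle_trans; [|apply (reg_sol_le_sing _ _ _ _ _ H2 HM n)].
    apply (reg_sol_below _ _ _ _ _ H1 HM n _
      (fun r => a2 r + p r * phi_cut M n (reg_sol a2 p M n r)) 0 t).
    + lra.
    + intros; eapply reg_sol_continuous; eauto.
    + intros; eapply reg_sol_derive; eauto; lra.
    + rewrite !reg_sol_before; lra.
    + intros r _. apply Rplus_le_compat_r, Ha.
  - apply (sing_sol_le _ _ _ _ _ H2 HM). intros n.
    apply Rle_trans with (reg_sol a1 p M n t + D * (t - 0)).
    2: pose proof (reg_sol_le_sing _ _ _ _ _ H1 HM n t); lra.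
    apply (reg_sol_below _ _ _ _ _ H2 HM n (fun x => reg_sol a1 p M n x + D * (x - 0))
      (fun r => (a1 r + p r * phi_cut M n (reg_sol a1 p M n r)) + D) 0 t).
    + lra.
    + intros r _. apply (continuous_plus (reg_sol a1 p M n) (fun x => D * (x - 0))).
      eapply reg_sol_continuous; eauto.
      apply is_derive_continuous with D. auto_derive; [trivial|ring].
    + intros r Hr. apply (is_derive_plus (reg_sol a1 p M n) (fun x => D * (x - 0))).
      eapply reg_sol_derive; eauto; lra. auto_derive; [trivial|ring].
    + rewrite !reg_sol_before; lra.
    + intros r Hr.
      assert (phi_cut M n (reg_sol a1 p M n r + D * (r - 0)) <= phi_cut M n (reg_sol a1 p M n r))
        by (apply phi_cut_decreasing; nra).
      pose proof (force_bounded _ _ _ _ H1 r). pose proof (Ha r). nra.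
Qed.

(** * Between y and w *)

(** In a circle of radius 1, this is the half-chord w of a cap of height y;
    [sagitta] is the inverse correspondence. *)
Definition chord (y : R) : R := sqrt (y * (2 - y)).

Lemma chord_sq y : 0 <= y <= 1 -> chord y ^ 2 = y * (2 - y).
Proof. intros H. unfold chord. rewrite pow2_sqrt; nra. Qed.

Lemma chord_pos y : 0 < y <= 1 -> 0 < chord y.
Proof. intros H. apply sqrt_lt_R0. nra. Qed.

Lemma chord_increasing x y : 0 <= x <= y -> y <= 1 -> chord x <= chord y.
Proof. intros H1 H2. apply sqrt_le_1_alt. nra. Qed.

Lemma chord_lt x y : 0 <= x < y -> y <= 1 -> chord x < chord y.
Proof. intros H1 H2. apply sqrt_lt_1_alt. split; nra. Qed.

Lemma phi_chord y : 0 <= y <= 1 -> phi (chord y) = (1 - y) / chord y.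
Proof.
  intros H. unfold phi. rewrite chord_sq by lra.
  replace (1 - y * (2 - y)) with ((1 - y) ^ 2) by ring. rewrite sqrt_pow2; lra.
Qed.

(** This is the nonlinearity of the equation for y. *)
Definition chord_ratio (y : R) : R := chord y / (1 - y).

Lemma chord_ratio_increasing x y : 0 <= x <= y -> y < 1 -> chord_ratio x <= chord_ratio y.
Proof.
  intros H1 H2. unfold chord_ratio, Rdiv. apply Rmult_le_compat.
  - apply sqrt_pos.
  - apply Rlt_le, Rinv_0_lt_compat; lra.
  - apply chord_increasing; lra.
  - apply Rinv_le_contravar; lra.
Qed.

(** The inequality that lets the constant [chord_ratio y] replace the ratio at [x]:
    equality holds at [x] = [y], and the ratio increases. *)
Lemma chord_ratio_phi x y : 0 < x <= y -> y < 1 -> 1 <= (1 - x) / chord x * chord_ratio y.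
Proof.
  intros H1 H2. pose proof (chord_pos x).
  apply Rle_trans with ((1 - x) / chord x * chord_ratio x).
  - right. unfold chord_ratio. field. lra.
  - apply Rmult_le_compat_l; [apply Rdiv_le_0_compat; lra|]. apply chord_ratio_increasing; lra.
Qed.

Lemma chord_derive y : 0 < y < 1 -> is_derive chord y ((1 - y) / chord y).
Proof.
  intros H. assert (0 < y * (2 - y)) by nra. assert (0 < sqrt (y * (2 - y))) by (apply sqrt_lt_R0; lra).
  unfold chord. auto_derive; [lra|]. unfold Rminus. field.
  unfold Rminus in *. lra.
Qed.

Lemma chord_continuous y : continuous chord y.
Proof.
  apply (continuous_comp (fun y => y * (2 - y)) sqrt).
  - apply is_derive_continuous with (2 - 2 * y). auto_derive; [trivial|ring].
  - apply continuous_sqrt.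
Qed.

Definition sagitta (w : R) : R := 1 - sqrt (1 - w ^ 2).

Lemma sagitta_continuous w : continuous sagitta w.
Proof.
  apply (continuous_minus (fun _ => 1) (fun w => sqrt (1 - w ^ 2))); [apply continuous_const|].
  apply (continuous_comp (fun w => 1 - w ^ 2) sqrt).
  - apply is_derive_continuous with (- (2 * w)). auto_derive; [trivial|ring].
  - apply continuous_sqrt.
Qed.

Lemma chord_sagitta w : 0 <= w <= 1 -> chord (sagitta w) = w.
Proof.
  intros H. unfold chord, sagitta.
  replace ((1 - sqrt (1 - w ^ 2)) * (2 - (1 - sqrt (1 - w ^ 2))))
    with (1 - sqrt (1 - w ^ 2) * sqrt (1 - w ^ 2)) by ring.
  rewrite sqrt_sqrt by nra. replace (1 - (1 - w ^ 2)) with (w ^ 2) by ring.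
  apply sqrt_pow2. lra.
Qed.

Lemma sagitta_bounds w : 0 < w < 1 -> 0 < sagitta w < 1.
Proof.
  intros H. unfold sagitta.
  assert (0 < sqrt (1 - w ^ 2)) by (apply sqrt_lt_R0; nra).
  assert (sqrt (1 - w ^ 2) < sqrt 1) by (apply sqrt_lt_1_alt; nra).
  rewrite sqrt_1 in *. lra.
Qed.

Lemma sagitta_0 : sagitta 0 = 0.
Proof. unfold sagitta. rewrite pow_i, Rminus_0_r, sqrt_1 by lia. ring. Qed.

(** The change of unknown, from the equation for w to the one for y. *)
Lemma sagitta_derive (W : R -> R) (a p t : R) :
  0 < W t < 1 -> is_derive W t (a + p * phi (W t)) ->
  is_derive (fun x => sagitta (W x)) t (a * chord_ratio (sagitta (W t)) + p).
Proof.
  intros H HD. assert (H1 : 0 < 1 - W t ^ 2) by nra.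
  assert (H2 : 0 < sqrt (1 - W t ^ 2)) by (apply sqrt_lt_R0; exact H1).
  unfold chord_ratio. rewrite chord_sagitta by lra. unfold sagitta.
  auto_derive.
  - split; [exists (a + p * phi (W t)); exact HD|]. split; [lra|trivial].
  - replace (Derive (fun x : R => W x) t) with (a + p * phi (W t))
      by (symmetry; apply is_derive_unique, HD). unfold phi.
    replace (W t * (W t * 1)) with (W t ^ 2) by ring.
    unfold Rminus in *. field. lra.
Qed.

(** * Estimates for the two shooting problems *)

Lemma RInt_nondecreasing (g : R -> R) x y : (forall t, continuous g t) -> (forall t, 0 <= g t) ->
  0 <= x <= y -> RInt g 0 x <= RInt g 0 y.
Proof.
  intros Cg Hg Hxy. rewrite <- (RInt_Chasles g 0 x y) by (apply ex_RInt_cont, Cg).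
  unfold plus; simpl.
  assert (0 <= RInt g x y); [|lra].
  apply RInt_ge_0; [lra|apply ex_RInt_cont, Cg|auto].
Qed.

Section Estimates.
Variables (a p : R -> R) (A P M : R).
Hypothesis Hc : coefficients a p A P.
Hypothesis HM : 0 < M < 1.

(** Written in terms of y, the barrier is B(r) = J(r) [chord_ratio b] plus the
    integral of the force. It stays below [b], and while y <= b the equation gives
    y' <= B'. The comparison is made in w, where the truncated solutions may exceed
    1 and have no y. *)
Lemma sing_sol_lt_chord J T b : 0 < T -> 0 < b < 1 -> chord b <= M ->
  (forall r, 0 <= r <= T -> continuous J r) -> J 0 = 0 ->
  (forall r, 0 < r < T -> is_derive J r (a r) /\ 0 < a r) ->
  J T * chord_ratio b + RInt p 0 T < b ->
  sing_sol a p M T < chord b.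
Proof.
  intros HT Hb HbM CJ J0 DJ Hfin.
  set (B := fun r => J r * chord_ratio b + RInt p 0 r).
  assert (Hp : forall r, 0 <= p r) by (intros; apply (force_bounded _ _ _ _ Hc)).
  assert (Cp := force_continuous _ _ _ _ Hc).
  assert (Hs : 0 < chord_ratio b).
  { apply Rdiv_lt_0_compat; [apply chord_pos; lra|lra]. }
  assert (CB : forall r, 0 <= r <= T -> continuous B r).
  { intros r Hr. apply (continuous_plus (fun r => J r * chord_ratio b) (fun r => RInt p 0 r)).
    - apply (continuous_mult J (fun _ => chord_ratio b)); [auto|apply continuous_const].
    - eapply is_derive_continuous. apply is_derive_RInt_cont, Cp. }
  assert (DB : forall r, 0 < r < T -> is_derive B r (a r * chord_ratio b + p r)).
  { intros r Hr. apply (is_derive_plus (fun r => J r * chord_ratio b) (fun r => RInt p 0 r)).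
    - destruct (DJ r Hr) as [D _]. auto_derive; [exists (a r); exact D|].
      replace (Derive (fun x : R => J x) r) with (a r) by (symmetry; apply is_derive_unique, D). ring.
    - apply is_derive_RInt_cont, Cp. }
  assert (Bpos : forall r, 0 < r <= T -> 0 < B r).
  { intros r Hr. destruct (mean_value J a 0 r) as [x [Hx E]]; try lra.
    - intros; apply CJ; lra.
    - intros; apply DJ; lra.
    - assert (0 <= RInt p 0 r) by (apply RInt_ge_0; [lra|apply ex_RInt_cont, Cp|auto]).
      assert (0 < J r) by (destruct (DJ x); [lra|]; nra).
      unfold B. nra. }
  assert (BT : forall r, 0 <= r <= T -> B r <= B T).
  { intros r Hr.
    pose proof (nondecreasing_of_derive B (fun r => a r * chord_ratio b + p r) 0 r T) as Hnd.
    assert (B r + 0 * (T - r) <= B T); [|lra].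
    apply Hnd; try lra.
    - intros; apply CB; lra.
    - intros; apply DB; lra.
    - intros x Hx. destruct (DJ x); [lra|]. specialize (Hp x). nra. }
  assert (HBT : B T < b) by exact Hfin.
  apply Rle_lt_trans with (chord (B T)).
  2: { apply chord_lt; [|lra]. split; [apply Rlt_le, Bpos; lra|lra]. }
  apply (sing_sol_le _ _ _ _ _ Hc HM). intros n.
  apply (reg_sol_below _ _ _ _ _ Hc HM n (fun r => chord (B r))
    (fun r => (a r * chord_ratio b + p r) * ((1 - B r) / chord (B r))) 0 T).
  - lra.
  - intros r Hr. apply (continuous_comp B chord); [apply CB, Hr|apply chord_continuous].
  - intros r Hr. apply (is_derive_comp chord B); [|apply DB, Hr].
    apply chord_derive. pose proof (BT r). pose proof (Bpos r). lra.
  - rewrite reg_sol_before by lra. apply sqrt_pos.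
  - intros r Hr. pose proof (BT r ltac:(lra)). pose proof (Bpos r ltac:(lra)).
    assert (phi_cut M n (chord (B r)) <= (1 - B r) / chord (B r)).
    { rewrite <- phi_chord by lra. apply phi_cut_le_phi. split; [apply chord_pos; lra|].
      apply Rle_trans with (chord b); [apply chord_increasing; lra|exact HbM]. }
    pose proof (chord_ratio_phi (B r) b ltac:(lra) ltac:(lra)).
    set (q := (1 - B r) / chord (B r)) in *. destruct (DJ r Hr) as [_ Ha].
    pose proof (Hp r).
    assert (p r * phi_cut M n (chord (B r)) <= p r * q) by (apply Rmult_le_compat_l; lra).
    assert (a r * 1 <= a r * (q * chord_ratio b)) by (apply Rmult_le_compat_l; lra).
    lra.
Qed.

(** While y < B <= I the equation gives y' >= p + a [chord_ratio I] = B', since here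
    the drift [a] is not positive. At [T] the force may vanish and the limit is not
    known to be positive, so that the bound is first obtained before [T]; it passes
    to [T] because the solution cannot fall faster than at speed [A]. *)
Lemma sing_sol_ge_chord J T I y : 0 < T -> 0 < I < 1 -> 0 <= y < 1 ->
  (forall r, continuous J r) -> J 0 = 0 ->
  (forall r, 0 < r < T -> is_derive J r (a r) /\ a r <= 0 /\ 0 < p r) ->
  (forall r, 0 < r < T -> sing_sol a p M r <= M) ->
  RInt p 0 T <= I ->
  y < RInt p 0 T + J T * chord_ratio I ->
  chord y <= sing_sol a p M T.
Proof.
  intros HT HI Hy CJ J0 DJ HW HpI Hfin.
  set (B := fun r => RInt p 0 r + J r * chord_ratio I).
  assert (Hp : forall r, 0 <= p r) by (intros; apply (force_bounded _ _ _ _ Hc)).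
  assert (Cp := force_continuous _ _ _ _ Hc).
  assert (Hs : 0 < chord_ratio I).
  { apply Rdiv_lt_0_compat; [apply chord_pos; lra|lra]. }
  assert (CB : forall r, continuous B r).
  { intros r. apply (continuous_plus (fun r => RInt p 0 r) (fun r => J r * chord_ratio I)).
    - eapply is_derive_continuous. apply is_derive_RInt_cont, Cp.
    - apply (continuous_mult J (fun _ => chord_ratio I)); [auto|apply continuous_const]. }
  assert (DB : forall r, 0 < r < T -> is_derive B r (p r + a r * chord_ratio I)).
  { intros r Hr. apply (is_derive_plus (fun r => RInt p 0 r) (fun r => J r * chord_ratio I)).
    - apply is_derive_RInt_cont, Cp.
    - destruct (DJ r Hr) as [D _]. auto_derive; [exists (a r); exact D|].
      replace (Derive (fun x : R => J x) r) with (a r) by (symmetry; apply is_derive_unique, D). ring. }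
  assert (Wpos : forall r, 0 < r < T -> 0 < sing_sol a p M r).
  { intros r Hr. apply (sing_sol_pos _ _ _ _ _ Hc HM); [lra|apply DJ, Hr]. }
  assert (DW : forall r, 0 < r < T ->
     is_derive (sing_sol a p M) r (a r + p r * phi (sing_sol a p M r))).
  { intros r Hr. rewrite <- (Rmin_right M (sing_sol a p M r)) by (apply HW, Hr).
    apply (sing_sol_derive _ _ _ _ _ Hc HM); [lra|auto]. }
  assert (Jneg : forall r, 0 <= r < T -> J r <= 0).
  { intros r Hr. apply Rle_trans with (J 0); [|lra].
    apply (comparison J (fun _ => J 0) a (fun _ => 0) 0 r); auto; try lra.
    - intros; apply continuous_const.
    - intros; apply DJ; lra.
    - intros x _. apply (is_derive_const (J 0) x).
    - intros x Hx _. destruct (DJ x); lra. }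
  assert (Hcmp : forall s, 0 < s < T -> B s <= sagitta (sing_sol a p M s)).
  { intros s Hs'.
    apply (comparison B (fun r => sagitta (sing_sol a p M r))
      (fun r => p r + a r * chord_ratio I)
      (fun r => a r * chord_ratio (sagitta (sing_sol a p M r)) + p r) 0 s); auto; try lra.
    - intros r Hr. apply (continuous_comp (sing_sol a p M) sagitta); [|apply sagitta_continuous].
      destruct (Req_dec r 0) as [->|Hr0]; [eapply sing_sol_continuous_0; eauto|].
      eapply is_derive_continuous. apply DW. lra.
    - intros; apply DB; lra.
    - intros r Hr. apply sagitta_derive; [|apply DW; lra].
      pose proof (Wpos r). pose proof (HW r). lra.
    - rewrite sing_sol_before, sagitta_0 by lra. unfold B. rewrite RInt_point, J0.
      unfold zero; simpl. lra.
    - intros r Hr Hlt. destruct (DJ r) as [_ [Ha _]]; [lra|].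
      assert (BI : B r <= I).
      { unfold B. pose proof (RInt_nondecreasing p r T Cp Hp).
        pose proof (Jneg r). nra. }
      assert (chord_ratio (sagitta (sing_sol a p M r)) <= chord_ratio I).
      { pose proof (Wpos r). pose proof (HW r).
        pose proof (sagitta_bounds (sing_sol a p M r)).
        apply chord_ratio_increasing; lra. }
      nra. }
  destruct (continuous_pos_near B T y (CB T)) as [d [Hd Hn]]; [exact Hfin|].
  assert (HA := drift_sup_nonneg _ _ _ _ Hc).
  apply Rnot_lt_le. intros Hlt.
  set (e := chord y - sing_sol a p M T).
  (* By contradiction: e is the deficit at T, and a time m / 2 is too short to lose
     it at speed A. *)
  set (m := Rmin (Rmin T d) (e / (A + 1))).
  assert (Hm : 0 < m).
  { repeat apply Rmin_glb_lt; try lra. apply Rdiv_lt_0_compat; unfold e; lra. }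
  assert (Hm1 : m <= T) by (eapply Rle_trans; [apply Rmin_l|apply Rmin_l]).
  assert (Hm2 : m <= d) by (eapply Rle_trans; [apply Rmin_l|apply Rmin_r]).
  assert (Hm3 : m <= e / (A + 1)) by apply Rmin_r.
  apply Rmult_le_compat_l with (r := A + 1) in Hm3; [|lra].
  replace ((A + 1) * (e / (A + 1))) with e in Hm3 by (field; lra).
  set (s := T - m / 2).
  assert (Hs2 : 0 < s < T) by (unfold s; lra).
  assert (Hsl : sing_sol a p M s + - A * (T - s) <= sing_sol a p M T).
  { apply (sing_sol_growth _ _ _ _ _ Hc HM); [lra|]. intros r _.
    pose proof (drift_bounded _ _ _ _ Hc r) as Hb. apply Rabs_le_between in Hb. lra. }
  assert (Hcs : chord y <= sing_sol a p M s).
  { pose proof (Wpos s Hs2). pose proof (HW s Hs2).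
    rewrite <- (chord_sagitta (sing_sol a p M s)) by lra.
    pose proof (sagitta_bounds (sing_sol a p M s) ltac:(lra)).
    apply chord_increasing; [|lra]. split; [lra|].
    apply Rle_trans with (2 := Hcmp s Hs2). apply Rlt_le, Hn. apply Rabs_def1; unfold s; lra. }
  unfold s, e in *. nra.
Qed.

(** Up to [sigma] the square root bound gives w <= 1/2 <= M. From [sigma] on the
    drift is at most [-m], which outweighs the force at the level M. *)
Lemma sing_sol_le_cap T sigma m : 0 < sigma < T -> 8 * P * sigma <= 1 -> 1 <= P ->
  / 2 <= M -> P * phi M <= m ->
  (forall r, 0 < r < T -> a r <= 0) -> (forall r, sigma < r < T -> a r <= - m) ->
  forall t, 0 <= t <= T -> sing_sol a p M t <= M.
Proof.
  intros Hsig HP8 HP1 HM2 Hm Ha Ham.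
  assert (Hearly : forall t, 0 <= t <= sigma -> sing_sol a p M t <= M).
  { intros t Ht.
    assert (Hsq : sqrt (2 * P * t) <= M).
    { apply Rle_trans with (/ 2); [|lra]. rewrite <- (sqrt_pow2 (/ 2)) by lra.
      apply sqrt_le_1_alt. nra. }
    apply Rle_trans with (2 := Hsq).
    apply (sing_sol_sqrt_bound _ _ _ _ _ Hc HM); try lra.
    intros r Hr. pose proof (Ha r ltac:(lra)).
    pose proof (force_bounded _ _ _ _ Hc r).
    assert (0 < / sqrt (2 * P * r)) by (apply Rinv_0_lt_compat, sqrt_lt_R0; nra).
    assert (p r * / sqrt (2 * P * r) <= P * / sqrt (2 * P * r))
      by (apply Rmult_le_compat_r; lra). lra. }
  intros t Ht. destruct (Rle_or_lt t sigma) as [Hts|Hts]; [apply Hearly; lra|].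
  apply (sing_sol_le _ _ _ _ _ Hc HM). intros n.
  apply (reg_sol_below _ _ _ _ _ Hc HM n (fun _ => M) (fun _ => 0) sigma t).
  - lra.
  - intros; apply continuous_const.
  - intros r _. apply (is_derive_const M r).
  - eapply Rle_trans; [apply (reg_sol_le_sing _ _ _ _ _ Hc HM)|]. apply Hearly; lra.
  - intros r Hr. pose proof (level_bounds M n (proj1 HM)).
    rewrite phi_cut_exact, Rmin_left by lra.
    pose proof (force_bounded _ _ _ _ Hc r). pose proof (phi_nonneg M (proj1 HM)).
    assert (p r * phi M <= P * phi M) by (apply Rmult_le_compat_r; lra).
    specialize (Ham r ltac:(lra)). lra.
Qed.
End Estimates.

(** * Functions given on the unit interval *)

(** Composition with [cut 0 1] extends a function from the unit interval to the
    line, constantly on both sides; this makes global existence and integrability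
    theorems available. *)
Lemma extension_continuous (g : R -> R) t :
  continuous_on I01 g -> continuous (fun s => g (cut 0 1 s)) t.
Proof.
  intros Hg.
  assert (Hb : forall s, I01 (cut 0 1 s)) by (intros s; apply cut_bounds; lra).
  apply (filterlim_comp _ _ _ (cut 0 1) g (locally t) (within I01 (locally (cut 0 1 t)))).
  - intros Q HQ. pose proof (cut_continuous 0 1 t _ HQ) as H.
    unfold filtermap in *. revert H. apply filter_imp. intros s Hs. apply Hs, Hb.
  - apply Hg, Hb.
Qed.

Lemma extension_bounded (g : R -> R) :
  continuous_on I01 g -> exists B, forall t, Rabs (g (cut 0 1 t)) <= B.
Proof.
  intros Hg.
  assert (Hc : forall c, 0 <= c <= 1 -> continuity_pt (fun s => Rabs (g (cut 0 1 s))) c).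
  { intros c _. apply continuity_pt_filterlim.
    apply (continuous_comp (fun s => g (cut 0 1 s)) Rabs).
    - apply extension_continuous, Hg.
    - apply continuous_Rabs. }
  destruct (continuity_ab_maj _ 0 1 ltac:(lra) Hc) as [x [Hx _]].
  exists (Rabs (g (cut 0 1 x))). intros t.
  pose proof (cut_bounds 0 1 t ltac:(lra)) as Hb.
  specialize (Hx _ Hb). simpl in Hx. rewrite (cut_id 0 1 (cut 0 1 t)) in Hx by lra. exact Hx.
Qed.

Lemma C1_on_continuous D g : C1_on D g -> continuous_on D g.
Proof.
  intros [dg [Hd _]] x Hx. specialize (Hd x Hx). apply cont_deriv in Hd.
  intros Q [eps HQ]. destruct (Hd eps (cond_pos eps)) as [d [Hd0 H]].
  exists (mkposreal d Hd0). intros z Hz HzD. apply HQ.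
  destruct (Req_dec x z) as [->|Hne]; [apply ball_center|].
  apply (H z). split; [split; [exact HzD|exact Hne]|exact Hz].
Qed.

Lemma C1_on_derive h dh x :
  D_in h dh I01 x -> 0 < x < 1 -> is_derive h x (dh x).
Proof.
  intros Hd Hx. apply is_derive_Reals. intros eps He.
  destruct (Hd eps He) as [d [Hd0 H]].
  assert (Hm : 0 < Rmin d (Rmin x (1 - x))) by (repeat apply Rmin_glb_lt; lra).
  exists (mkposreal _ Hm). intros k Hk0 Hk. simpl in Hk.
  pose proof (Rmin_l d (Rmin x (1 - x))). pose proof (Rmin_r d (Rmin x (1 - x))).
  pose proof (Rmin_l x (1 - x)). pose proof (Rmin_r x (1 - x)).
  apply Rabs_def2 in Hk.
  specialize (H (x + k)). simpl in H. unfold R_dist in H.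
  replace (x + k - x) with k in H by ring. apply H.
  split; [split|].
  - unfold I01. lra.
  - lra.
  - apply Rabs_def1; lra.
Qed.

Lemma RInt_reflect (g : R -> R) s : (forall t, continuous g t) ->
  RInt (fun r => g (1 - r)) 0 s = RInt g (1 - s) 1.
Proof.
  intros Cg.
  pose proof (RInt_comp_lin g (-1) 1 0 s) as E.
  replace (-1 * 0 + 1) with 1 in E by ring. replace (-1 * s + 1) with (1 - s) in E by ring.
  specialize (E (ex_RInt_cont _ _ _ Cg)).
  rewrite <- (opp_RInt_swap g) by (apply ex_RInt_cont, Cg).
  rewrite <- E.
  rewrite <- (RInt_opp (fun y => scal (-1) (g (-1 * y + 1)))).
  - apply RInt_ext. intros r _. unfold opp, scal; simpl. unfold mult; simpl.
    replace (-1 * r + 1) with (1 - r) by ring. ring.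
  - apply ex_RInt_cont. intros t. apply (continuous_scal_r (-1) (fun y => g (-1 * y + 1))).
    apply (continuous_comp (fun y => -1 * y + 1) g); [|apply Cg].
    apply is_derive_continuous with (-1). auto_derive; [trivial|ring].
Qed.

Lemma is_derive_glue (f g : R -> R) x l :
  is_derive f x l -> is_derive g x l -> f x = g x ->
  is_derive (fun u => if Rle_dec u x then f u else g u) x l.
Proof.
  intros Hf Hg E. apply is_derive_Reals in Hf. apply is_derive_Reals in Hg.
  apply is_derive_Reals. intros eps He.
  destruct (Hf eps He) as [d1 H1]. destruct (Hg eps He) as [d2 H2].
  assert (Hm : 0 < Rmin d1 d2) by (apply Rmin_glb_lt; apply cond_pos).
  exists (mkposreal _ Hm). intros k Hk0 Hk. simpl in Hk.
  pose proof (Rmin_l d1 d2). pose proof (Rmin_r d1 d2).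
  destruct (Rle_dec x x) as [_|n]; [|lra].
  destruct (Rle_dec (x + k) x).
  - apply H1; [exact Hk0|lra].
  - rewrite E. apply H2; [exact Hk0|lra].
Qed.

(** * Shooting from both ends *)

(** [k] is a version of h' that is continuous, nonnegative and bounded on the whole
    line, whatever the values of [Derive h] outside the open unit interval. *)
Record profile (h k : R -> R) (K : R) : Prop := {
  profile_continuous : forall t, continuous (fun s => h (cut 0 1 s)) t;
  profile_derive : forall t, 0 < t < 1 -> is_derive h t (k t);
  profile_slope_pos : forall t, 0 < t < 1 -> 0 < k t;
  profile_slope_continuous : forall t, continuous k t;
  profile_slope_bounds : forall t, 0 <= k t <= K }.

Lemma continuous_Rmax_0 (g : R -> R) t : continuous g t -> continuous (fun s => Rmax (g s) 0) t.
Proof.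
  intros Hg. apply (continuous_comp g (fun x => Rmax x 0)); [exact Hg|].
  apply (lipschitz_continuous _ 1). intros y. rewrite Rmult_1_l.
  rewrite (Rmax_comm y), (Rmax_comm (g t)). apply Rmax_nonexpansive.
Qed.

Lemma C1_profile h : C1_on I01 h -> (forall u, 0 < u < 1 -> 0 < Derive h u) ->
  exists k K, profile h k K.
Proof.
  intros Hh Hpos. assert (Ch := C1_on_continuous _ _ Hh).
  destruct Hh as [dh [Hd Cd]].
  destruct (extension_bounded dh Cd) as [K HK].
  assert (Hdh : forall t, 0 < t < 1 -> is_derive h t (dh t)).
  { intros t Ht. apply C1_on_derive; [|exact Ht]. apply Hd. unfold I01; lra. }
  assert (Hdp : forall t, 0 < t < 1 -> 0 < dh t).
  { intros t Ht. rewrite <- (is_derive_unique _ _ _ (Hdh t Ht)). auto. }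
  exists (fun t => Rmax (dh (cut 0 1 t)) 0), K. split.
  - intros t. apply extension_continuous, Ch.
  - intros t Ht. rewrite cut_id by lra.
    rewrite Rmax_left by (apply Rlt_le; auto). auto.
  - intros t Ht. rewrite cut_id by lra. rewrite Rmax_left by (apply Rlt_le; auto). auto.
  - intros t. apply continuous_Rmax_0, extension_continuous, Cd.
  - intros t. specialize (HK t). apply Rabs_le_between in HK. split; [apply Rmax_r|].
    apply Rmax_lub; lra.
Qed.

Lemma profile_extension_derive h k K t : profile h k K -> 0 < t < 1 ->
  is_derive (fun s => h (cut 0 1 s)) t (k t).
Proof.
  intros Hp Ht. apply (is_derive_ext_loc h); [|apply (profile_derive _ _ _ Hp), Ht].
  assert (Hm : 0 < Rmin t (1 - t)) by (apply Rmin_glb_lt; lra).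
  exists (mkposreal _ Hm). intros x Hx. change (Rabs (x - t) < Rmin t (1 - t)) in Hx.
  pose proof (Rmin_l t (1 - t)). pose proof (Rmin_r t (1 - t)). apply Rabs_def2 in Hx.
  rewrite cut_id; lra.
Qed.

(** On the left the time is u itself, on the right it is s = 1 - u; hence the
    reflections in [right_drift] and [right_force]. *)
Definition left_drift (k : R -> R) (c t : R) : R := c + k t.
Definition right_drift (k : R -> R) (c s : R) : R := - (c + k (1 - s)).
Definition left_force (f : R -> R) (t : R) : R := neg_part f (cut 0 1 t).
Definition right_force (f : R -> R) (s : R) : R := pos_part f (cut 0 1 (1 - s)).

Lemma continuous_reflect (g : R -> R) t : (forall t, continuous g t) ->
  continuous (fun s => g (1 - s)) t.
Proof.
  intros Cg. apply (continuous_comp (fun s => 1 - s) g); [|apply Cg].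
  apply is_derive_continuous with (-1). auto_derive; [trivial|ring].
Qed.

Lemma is_derive_reflect (g : R -> R) t l : is_derive g (1 - t) l ->
  is_derive (fun s => g (1 - s)) t (- l).
Proof.
  intros Dg. replace (- l) with (-1 * l) by ring.
  apply (is_derive_comp g (fun s => 1 - s)); [exact Dg|].
  auto_derive; [trivial|ring].
Qed.

Lemma left_coefficients f h k K P c : profile h k K -> continuous_on I01 f ->
  (forall t, Rabs (f (cut 0 1 t)) <= P) ->
  coefficients (left_drift k c) (left_force f) (Rabs c + K) P.
Proof.
  intros Hp Cf HP. split.
  - intros t. apply (continuous_plus (fun _ => c) k); [apply continuous_const|].
    apply (profile_slope_continuous _ _ _ Hp).
  - intros t. unfold left_drift. eapply Rle_trans; [apply Rabs_triang|].
    apply Rplus_le_compat_l. pose proof (profile_slope_bounds _ _ _ Hp t).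
    rewrite Rabs_right; lra.
  - intros t. apply (continuous_Rmax_0 (fun s => - f (cut 0 1 s))).
    apply (continuous_opp (fun s => f (cut 0 1 s))), extension_continuous, Cf.
  - intros t. specialize (HP t). apply Rabs_le_between in HP. split; [apply Rmax_r|].
    apply Rmax_lub; lra.
Qed.

Lemma right_coefficients f h k K P c : profile h k K -> continuous_on I01 f ->
  (forall t, Rabs (f (cut 0 1 t)) <= P) ->
  coefficients (right_drift k c) (right_force f) (Rabs c + K) P.
Proof.
  intros Hp Cf HP. split.
  - intros t. apply (continuous_opp (fun s => c + k (1 - s))).
    apply (continuous_plus (fun _ => c) (fun s => k (1 - s))); [apply continuous_const|].
    apply continuous_reflect, (profile_slope_continuous _ _ _ Hp).
  - intros t. unfold right_drift. rewrite Rabs_Ropp. eapply Rle_trans; [apply Rabs_triang|].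
    apply Rplus_le_compat_l. pose proof (profile_slope_bounds _ _ _ Hp (1 - t)).
    rewrite Rabs_right; lra.
  - intros t. apply (continuous_reflect (fun s => pos_part f (cut 0 1 s))). intros s.
    apply (continuous_Rmax_0 (fun s => f (cut 0 1 s))), extension_continuous, Cf.
  - intros t. specialize (HP (1 - t)). apply Rabs_le_between in HP. split; [apply Rmax_r|].
    apply Rmax_lub; lra.
Qed.

(** The gap between both arrival values increases with the speed and is Lipschitz in
    it; it is negative at 0 and positive at 2 / u0, since there the left solution,
    whose drift is at least c, arrives at 2 or above. *)
Lemma matching_speed f h k K P M u0 :
  profile h k K -> continuous_on I01 f -> (forall t, Rabs (f (cut 0 1 t)) <= P) ->
  0 < M < 1 -> 0 < u0 < 1 ->
  (forall c, 0 <= c -> sing_sol (right_drift k c) (right_force f) M (1 - u0) <= M) ->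
  sing_sol (left_drift k 0) (left_force f) M u0
    < sing_sol (right_drift k 0) (right_force f) M (1 - u0) ->
  exists c, 0 < c /\
    sing_sol (left_drift k c) (left_force f) M u0
      = sing_sol (right_drift k c) (right_force f) M (1 - u0).
Proof.
  intros Hp Cf HP HM Hu Hcap H0.
  pose proof (fun c => left_coefficients f h k K P c Hp Cf HP) as HL.
  pose proof (fun c => right_coefficients f h k K P c Hp Cf HP) as HR.
  set (gap := fun c => sing_sol (left_drift k c) (left_force f) M u0
                     - sing_sol (right_drift k c) (right_force f) M (1 - u0)).
  assert (Hmon : forall c d, c <= d -> 0 <= gap d - gap c <= d - c).
  { intros c d Hcd.
    destruct (sing_sol_drift _ _ _ _ _ _ M (d - c) u0 (HL c) (HL d) HM) as [L1 L2].
    { intros s. unfold left_drift. lra. } { lra. }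
    destruct (sing_sol_drift _ _ _ _ _ _ M (d - c) (1 - u0) (HR d) (HR c) HM) as [R1 R2].
    { intros s. unfold right_drift. lra. } { lra. }
    unfold gap. nra. }
  assert (Hcont : continuity gap).
  { intros c. apply continuity_pt_filterlim. apply (lipschitz_continuous gap 1). intros d.
    rewrite Rmult_1_l. destruct (Rle_or_lt c d) as [Hcd|Hcd].
    - pose proof (Hmon c d Hcd). rewrite !Rabs_right; lra.
    - pose proof (Hmon d c ltac:(lra)). rewrite Rabs_left1, (Rabs_left (d - c)); lra. }
  assert (Hneg : gap 0 < 0) by (unfold gap; lra).
  assert (Hc1 : 0 < 2 / u0) by (apply Rdiv_lt_0_compat; lra).
  assert (Hpos : 0 <= gap (2 / u0)).
  { pose proof (sing_sol_growth _ _ _ _ _ (HL (2 / u0)) HM (2 / u0) 0 u0) as Hs.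
    rewrite sing_sol_before in Hs by lra.
    replace (0 + 2 / u0 * (u0 - 0)) with 2 in Hs by (field; lra).
    assert (2 <= sing_sol (left_drift k (2 / u0)) (left_force f) M u0).
    { apply Hs; [lra|]. intros r _. unfold left_drift.
      pose proof (profile_slope_bounds _ _ _ Hp r). lra. }
    pose proof (Hcap (2 / u0) ltac:(lra)). unfold gap. lra. }
  destruct (IVT_cor gap 0 (2 / u0) Hcont) as [c [Hc Ec]]; [lra|nra|].
  exists c. split.
  - destruct (Req_dec c 0) as [->|]; lra.
  - unfold gap in Ec. lra.
Qed.

(** The left solution increases, hence stays below its value at [u0], which is the
    arrival value of the right one and thus at most M < 1. Both halves solve the
    equation also at [u0], where f vanishes, and have there the derivative c +
    h'(u0). *)
Lemma matched_solution f h k K P M u0 c :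
  type_C f u0 -> profile h k K -> continuous_on I01 f ->
  (forall t, Rabs (f (cut 0 1 t)) <= P) ->
  0 < M < 1 -> 0 < c ->
  (forall s, 0 <= s <= 1 - u0 -> sing_sol (right_drift k c) (right_force f) M s <= M) ->
  sing_sol (left_drift k c) (left_force f) M u0
    = sing_sol (right_drift k c) (right_force f) M (1 - u0) ->
  admissible f h c.
Proof.
  intros HC Hp Cf HP HM Hc0 Hcap Hmatch.
  destruct HC as [_ [_ [Hu [Hfu [Hfneg Hfpos]]]]].
  pose proof (left_coefficients f h k K P c Hp Cf HP) as HL.
  pose proof (right_coefficients f h k K P c Hp Cf HP) as HR.
  set (WL := sing_sol (left_drift k c) (left_force f) M) in *.
  set (WR := sing_sol (right_drift k c) (right_force f) M) in *.
  assert (Hk := profile_slope_bounds _ _ _ Hp).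
  assert (HLmono : forall r s, 0 <= r <= s -> WL r + c * (s - r) <= WL s).
  { intros r s Hrs. apply (sing_sol_growth _ _ _ _ _ HL HM); [exact Hrs|].
    intros x _. unfold left_drift. specialize (Hk x). lra. }
  assert (HL0 : WL 0 = 0) by (apply sing_sol_before; lra).
  assert (HR0 : WR 0 = 0) by (apply sing_sol_before; lra).
  assert (HLb : forall u, 0 < u <= u0 -> 0 < WL u <= M).
  { intros u Hur. pose proof (HLmono 0 u ltac:(lra)). pose proof (HLmono u u0 ltac:(lra)).
    pose proof (Hcap (1 - u0) ltac:(lra)). rewrite HL0 in *. nra. }
  assert (HRb : forall s, 0 < s <= 1 - u0 -> 0 < WR s <= M).
  { intros s Hs. split; [|apply Hcap; lra].
    destruct (Req_dec s (1 - u0)) as [->|Hne].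
    - rewrite <- Hmatch. apply HLb. lra.
    - apply (sing_sol_pos _ _ _ _ _ HR HM); [lra|].
      unfold right_force, pos_part. rewrite cut_id by lra.
      apply Rlt_le_trans with (2 := Rmax_l _ _). apply Hfpos. lra. }
  assert (DL : forall u, 0 < u <= u0 -> is_derive WL u ((c + k u) + - f u * phi (WL u))).
  { intros u Hur.
    pose proof (sing_sol_derive _ _ _ _ _ HL HM u ltac:(lra) (proj1 (HLb u Hur))) as D.
    fold WL in D. rewrite Rmin_right in D by (apply HLb, Hur).
    replace (left_force f u) with (- f u) in D; [exact D|].
    unfold left_force, neg_part. rewrite cut_id by lra. rewrite Rmax_left; [reflexivity|].
    destruct (Req_dec u u0) as [->|]; [lra|]. specialize (Hfneg u). lra. }
  assert (DR : forall u, u0 <= u < 1 ->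
     is_derive (fun u => WR (1 - u)) u ((c + k u) + - f u * phi (WR (1 - u)))).
  { intros u Hur.
    pose proof (sing_sol_derive _ _ _ _ _ HR HM (1 - u) ltac:(lra)
      (proj1 (HRb (1 - u) ltac:(lra)))) as D.
    fold WR in D. rewrite Rmin_right in D by (apply HRb; lra).
    apply is_derive_reflect in D.
    replace (right_force f (1 - u)) with (f u) in D.
    2: { unfold right_force, pos_part. replace (1 - (1 - u)) with u by ring.
      rewrite cut_id by lra. rewrite Rmax_left; [reflexivity|].
      destruct (Req_dec u u0) as [->|]; [lra|]. specialize (Hfpos u). lra. }
    unfold right_drift in D. replace (1 - (1 - u)) with u in D by ring.
    replace (c + k u + - f u * phi (WR (1 - u)))
      with (- (- (c + k u) + f u * phi (WR (1 - u)))) by ring. exact D. }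
  set (w := fun u => if Rle_dec u u0 then WL u else WR (1 - u)).
  assert (HwL : forall u, u <= u0 -> w u = WL u).
  { intros u Hur. unfold w. destruct (Rle_dec u u0); [reflexivity|lra]. }
  assert (HwR : forall u, u0 <= u -> w u = WR (1 - u)).
  { intros u Hur. unfold w. destruct (Rle_dec u u0); [|reflexivity].
    replace u with u0 by lra. exact Hmatch. }
  assert (Hwb : forall u, 0 < u < 1 -> 0 < w u <= M).
  { intros u Hur. destruct (Rle_or_lt u u0).
    - rewrite HwL by lra. apply HLb; lra.
    - rewrite HwR by lra. apply HRb; lra. }
  assert (Dw : forall u, 0 < u < 1 -> is_derive w u ((c + k u) + - f u * phi (w u))).
  { intros u Hur. destruct (Rtotal_order u u0) as [Hlt|[->|Hgt]].
    - rewrite HwL by lra. apply (is_derive_ext_loc WL); [|apply DL; lra].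
      assert (Hd : 0 < u0 - u) by lra. exists (mkposreal _ Hd). intros x Hx.
      change (Rabs (x - u) < u0 - u) in Hx. apply Rabs_def2 in Hx. rewrite HwL; [reflexivity|lra].
    - rewrite HwL by lra. apply is_derive_glue.
      + apply DL; lra.
      + rewrite Hmatch. apply (DR u0). lra.
      + exact Hmatch.
    - rewrite HwR by lra. apply (is_derive_ext_loc (fun x => WR (1 - x))); [|apply DR; lra].
      assert (Hd : 0 < u - u0) by lra. exists (mkposreal _ Hd). intros x Hx.
      change (Rabs (x - u) < u - u0) in Hx. apply Rabs_def2 in Hx. rewrite HwR; [reflexivity|lra]. }
  assert (Cw : forall u, 0 <= u <= 1 -> continuous w u).
  { intros u Hur. destruct (Req_dec u 0) as [->|Hn0]; [|destruct (Req_dec u 1) as [->|Hn1]].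
    - apply (continuous_ext_loc _ WL).
      + exists (mkposreal u0 (proj1 Hu)). intros x Hx.
        change (Rabs (x - 0) < u0) in Hx. apply Rabs_def2 in Hx. rewrite HwL; [reflexivity|lra].
      + apply (sing_sol_continuous_0 _ _ _ _ _ HL HM).
    - apply (continuous_ext_loc _ (fun x => WR (1 - x))).
      + assert (Hd : 0 < 1 - u0) by lra. exists (mkposreal _ Hd). intros x Hx.
        change (Rabs (x - 1) < 1 - u0) in Hx. apply Rabs_def2 in Hx. rewrite HwR; [reflexivity|lra].
      + apply (continuous_comp (fun x => 1 - x) WR).
        * apply is_derive_continuous with (-1). auto_derive; [trivial|ring].
        * replace (1 - 1) with 0 by ring. apply (sing_sol_continuous_0 _ _ _ _ _ HR HM).
    - eapply is_derive_continuous. apply Dw. lra. }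
  exists (fun u => sagitta (w u)). refine (conj _ (conj _ (conj _ (conj _ _)))).
  - intros u Hur. apply (filterlim_filter_le_1 (F := locally u)).
    + apply filter_le_within.
    + apply (continuous_comp w sagitta); [apply Cw, Hur|apply sagitta_continuous].
  - intros u Hur.
    rewrite (is_derive_unique _ _ _ (profile_derive _ _ _ Hp u Hur)).
    apply (sagitta_derive w (c + k u) (- f u)); [|apply Dw, Hur].
    specialize (Hwb u Hur). lra.
  - rewrite HwL, HL0 by lra. apply sagitta_0.
  - rewrite HwR by lra. replace (1 - 1) with 0 by ring. rewrite HR0. apply sagitta_0.
  - intros u Hur. specialize (Hwb u Hur). apply sagitta_bounds. lra.
Qed.

(** * The forces and their integrals *)

Lemma left_force_integral f u0 : continuous_on I01 f -> 0 < u0 < 1 ->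
  RInt (left_force f) 0 u0 <= Fminus f.
Proof.
  intros Cf Hu.
  assert (Cl : forall t, continuous (left_force f) t).
  { intros t. apply (continuous_Rmax_0 (fun s => - f (cut 0 1 s))).
    apply (continuous_opp (fun s => f (cut 0 1 s))), extension_continuous, Cf. }
  replace (Fminus f) with (RInt (left_force f) 0 1).
  - apply RInt_nondecreasing; [exact Cl|intros; apply Rmax_r|lra].
  - apply RInt_ext. intros x Hx. rewrite Rmin_left, Rmax_right in Hx by lra.
    unfold left_force. rewrite cut_id; [reflexivity|lra].
Qed.

Lemma right_force_integral f u : continuous_on I01 f -> 0 <= u <= 1 ->
  RInt (right_force f) 0 (1 - u) = RInt (pos_part f) u 1.
Proof.
  intros Cf Hu.
  rewrite (RInt_reflect (fun s => pos_part f (cut 0 1 s))).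
  - replace (1 - (1 - u)) with u by ring. apply RInt_ext. intros x Hx.
    rewrite Rmin_left, Rmax_right in Hx by lra. rewrite cut_id; [reflexivity|lra].
  - intros t. apply (continuous_Rmax_0 (fun s => f (cut 0 1 s))), extension_continuous, Cf.
Qed.

Lemma Fplus_right f u0 : continuous_on I01 f -> type_C f u0 ->
  RInt (pos_part f) u0 1 = Fplus f.
Proof.
  intros Cf [_ [_ [Hu [_ [Hn _]]]]]. unfold Fplus.
  assert (Hex : forall a b, 0 <= a <= b -> b <= 1 -> ex_RInt (pos_part f) a b).
  { intros a b H1 H2. apply (ex_RInt_ext (fun s => pos_part f (cut 0 1 s))).
    - intros x Hx. rewrite Rmin_left, Rmax_right in Hx by lra. rewrite cut_id; [reflexivity|lra].
    - apply ex_RInt_cont. intros t.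
      apply (continuous_Rmax_0 (fun s => f (cut 0 1 s))), extension_continuous, Cf. }
  assert (E : RInt (pos_part f) 0 u0 + RInt (pos_part f) u0 1 = RInt (pos_part f) 0 1)
    by (apply (RInt_Chasles (pos_part f)); apply Hex; lra).
  assert (E0 : RInt (pos_part f) 0 u0 = (u0 - 0) * 0).
  { transitivity (RInt (fun _ => 0) 0 u0); [|exact (RInt_const 0 u0 0)].
    apply RInt_ext. intros x Hx. rewrite Rmin_left, Rmax_right in Hx by lra.
    specialize (Hn x ltac:(lra)). unfold pos_part. apply Rmax_right; lra. }
  lra.
Qed.

(** phi tends to 0 at 1: take M = sqrt (1 - q^2), for which phi(M) = q / M <= 2 q,
    with q small. *)
Lemma cap_exists P m b : 0 < P -> 0 < m -> b < 1 ->
  exists M, 0 < M < 1 /\ / 2 <= M /\ P * phi M <= m /\ chord b <= M.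
Proof.
  intros HP Hm Hb.
  set (q := Rmin (/ 2) (Rmin (m / (2 * P)) (1 - b))).
  assert (Hq : 0 < q) by (repeat apply Rmin_glb_lt; try lra; apply Rdiv_lt_0_compat; lra).
  assert (Hq1 : q <= / 2) by apply Rmin_l.
  assert (Hq2 : q <= m / (2 * P)) by (eapply Rle_trans; [apply Rmin_r|apply Rmin_l]).
  assert (Hq3 : q <= 1 - b) by (eapply Rle_trans; [apply Rmin_r|apply Rmin_r]).
  exists (sqrt (1 - q ^ 2)).
  assert (Hhalf : / 2 <= sqrt (1 - q ^ 2)).
  { rewrite <- (sqrt_pow2 (/ 2)) by lra. apply sqrt_le_1_alt. nra. }
  repeat split; try lra.
  - apply Rlt_le_trans with (sqrt 1); [|rewrite sqrt_1; lra]. apply sqrt_lt_1_alt. split; nra.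
  - unfold phi. rewrite pow2_sqrt by nra. replace (1 - (1 - q ^ 2)) with (q ^ 2) by ring.
    rewrite sqrt_pow2 by lra.
    assert (q / sqrt (1 - q ^ 2) <= q * 2).
    { apply Rmult_le_compat_l; [lra|]. replace 2 with (/ / 2) by (field).
      apply Rinv_le_contravar; lra. }
    apply Rmult_le_compat_l with (r := 2 * P) in Hq2; [|lra].
    replace (2 * P * (m / (2 * P))) with m in Hq2 by (field; lra). nra.
  - apply sqrt_le_1_alt. nra.
Qed.

Theorem proposition4p5 (f h : R -> R) (u0 eta : R)
  (f_C1 : C1_on I01 f)
  (f_type_C : type_C f u0)
  (int_f_pos : 0 < RInt f 0 1)
  (int_fminus_lt1 : Fminus f < 1)
  (h_C1 : C1_on I01 h)
  (h_0 : h 0 = 0)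
  (dh_pos : forall u, 0 < u < 1 -> 0 < Derive h u)
  (h_u0 : h u0 < 1 + h 0)
  (eta_bounds : 0 < eta < Rmin (Fplus f) 1 - Fminus f)
  (h_left :
     h u0 - h 0 <
       (1 - Fminus f - eta)
         / sqrt ((Fminus f + eta) * (2 - Fminus f - eta)) * eta)
  (h_right :
     (Fplus f < 1 /\
      h 1 - h u0 <
        (1 - Fplus f) / sqrt (Fplus f * (2 - Fplus f))
          * (Fplus f - Fminus f - eta))
     \/
     (1 <= Fplus f /\
      exists zeta xi0 : R,
        0 < zeta < 1 - Fminus f - eta /\
        u0 < xi0 < 1 /\
        RInt f xi0 1 = 1 - zeta /\
        h xi0 - h u0 <
          sqrt (1 - ((1 + zeta - Fminus f - eta) / 2) ^ 2)
            - sqrt (1 - (1 - Fminus f - eta) ^ 2) /\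
        h 1 - h xi0 <
          (1 - zeta - Fminus f - eta) / 2 * (zeta / sqrt (1 - zeta ^ 2)))) :
  exists c : R, 0 < c /\ admissible f h c.
Proof.
  assert (Cf := C1_on_continuous _ _ f_C1).
  destruct (C1_profile h h_C1 dh_pos) as [k [K Hp]].
  destruct (extension_bounded f Cf) as [P0 HP0].
  set (P := Rmax P0 1).
  assert (HP1 : 1 <= P) by apply Rmax_r.
  assert (HP : forall t, Rabs (f (cut 0 1 t)) <= P).
  { intros t. eapply Rle_trans; [apply HP0|apply Rmax_l]. }
  assert (HC := f_type_C). destruct HC as [_ [_ [Hu [_ [Hfneg Hfpos]]]]].
  set (b := Fminus f + eta).
  assert (HF0 : 0 <= Fminus f).
  { pose proof (left_coefficients f h k K P 0 Hp Cf HP) as HL.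
    eapply Rle_trans; [|apply left_force_integral; eauto].
    apply RInt_ge_0; [lra|apply ex_RInt_cont, (force_continuous _ _ _ _ HL)|].
    intros x _. apply (force_bounded _ _ _ _ HL). }
  pose proof (Rmin_l (Fplus f) 1). pose proof (Rmin_r (Fplus f) 1).
  assert (Hb : 0 < b < 1) by (unfold b; lra).
  assert (HbF : b < Fplus f) by (unfold b; lra).
  (* At time 1 / (8 P) the bound sqrt (2 P s) reaches 1/2; h' is bounded below by a
     positive constant on [u0, 1 - sigma] only, as it may vanish at 1. *)
  set (sigma := Rmin (/ (8 * P)) ((1 - u0) / 2)).
  assert (Hsig : 0 < sigma).
  { apply Rmin_glb_lt; [apply Rinv_0_lt_compat|]; lra. }
  assert (Hsig1 : sigma <= / (8 * P)) by apply Rmin_l.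
  assert (Hsig2 : sigma <= (1 - u0) / 2) by apply Rmin_r.
  assert (Hsig3 : 8 * P * sigma <= 1).
  { apply Rmult_le_compat_l with (r := 8 * P) in Hsig1; [|lra].
    rewrite Rinv_r in Hsig1 by lra. exact Hsig1. }
  destruct (continuity_ab_min k u0 (1 - sigma)) as [x0 [Hmin Hx0]]; [lra| |].
  { intros x _. apply continuity_pt_filterlim, (profile_slope_continuous _ _ _ Hp). }
  assert (Hm : 0 < k x0) by (apply (profile_slope_pos _ _ _ Hp); lra).
  destruct (cap_exists P (k x0) b) as [M [HM [HM2 [HMP HbM]]]]; try lra.
  pose proof (fun c => left_coefficients f h k K P c Hp Cf HP) as HL.
  pose proof (fun c => right_coefficients f h k K P c Hp Cf HP) as HR.
  assert (Hcap : forall c s, 0 <= c -> 0 <= s <= 1 - u0 ->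
     sing_sol (right_drift k c) (right_force f) M s <= M).
  { intros c s Hc Hs.
    apply (sing_sol_le_cap _ _ _ _ _ (HR c) HM (1 - u0) sigma (k x0)); auto; try lra.
    - intros r _. unfold right_drift. pose proof (profile_slope_bounds _ _ _ Hp (1 - r)). lra.
    - intros r Hr. unfold right_drift. pose proof (Hmin (1 - r)). lra. }
  assert (Hleft : sing_sol (left_drift k 0) (left_force f) M u0 < chord b).
  { apply (sing_sol_lt_chord _ _ _ _ _ (HL 0) HM (fun s => h (cut 0 1 s))); try lra; auto.
    - intros r _. apply (profile_continuous _ _ _ Hp).
    - rewrite cut_id; lra.
    - intros r Hr. unfold left_drift. rewrite Rplus_0_l. split.
      + apply (profile_extension_derive _ _ _ _ Hp); lra.
      + apply (profile_slope_pos _ _ _ Hp); lra.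
    - rewrite cut_id by lra.
      pose proof (left_force_integral f u0 Cf Hu).
      assert (Eb : b = Fminus f + eta) by reflexivity.
      assert (h u0 * chord_ratio b < eta); [|lra].
      assert (Hch := chord_pos b ltac:(lra)).
      replace ((Fminus f + eta) * (2 - Fminus f - eta)) with (b * (2 - b)) in h_left
        by (unfold b; ring).
      change (sqrt (b * (2 - b))) with (chord b) in h_left.
      replace (1 - Fminus f - eta) with (1 - b) in h_left by (unfold b; ring).
      rewrite h_0, Rminus_0_r in h_left.
      assert (Hs : 0 < chord_ratio b) by (apply Rdiv_lt_0_compat; lra).
      apply Rmult_lt_compat_r with (r := chord_ratio b) in h_left; [|exact Hs].
      replace ((1 - b) / chord b * eta * chord_ratio b) with eta in h_left
        by (unfold chord_ratio; field; lra).
      exact h_left. }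
  (* J is minus the increment of h over [1 - s, 1], a primitive of the drift at
     speed 0. *)
  set (J := fun s => h (cut 0 1 (1 - s)) - h (cut 0 1 1)).
  assert (CJ : forall s, continuous J s).
  { intros s. apply (continuous_minus (fun s => h (cut 0 1 (1 - s))) (fun _ => h (cut 0 1 1))).
    - apply (continuous_reflect (fun s => h (cut 0 1 s))), (profile_continuous _ _ _ Hp).
    - apply continuous_const. }
  assert (J0 : J 0 = 0) by (unfold J; rewrite Rminus_0_r; ring).
  assert (DJ : forall s, 0 < s < 1 -> is_derive J s (right_drift k 0 s)).
  { intros s Hs. unfold right_drift. rewrite Rplus_0_l.
    rewrite <- (Rminus_0_r (- k (1 - s))).
    apply (is_derive_minus (fun s => h (cut 0 1 (1 - s))) (fun _ => h (cut 0 1 1))).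
    - apply (is_derive_reflect (fun s => h (cut 0 1 s))).
      apply (profile_extension_derive _ _ _ _ Hp). lra.
    - apply (is_derive_const (h (cut 0 1 1)) s). }
  assert (HJ : forall u, 0 <= u <= 1 -> J (1 - u) = h u - h 1).
  { intros u Hu'. unfold J. replace (1 - (1 - u)) with u by ring.
    rewrite !cut_id by lra. reflexivity. }
  assert (Hstart : forall u I y, u0 <= u < 1 -> 0 < I < 1 -> 0 <= y < 1 ->
     RInt (pos_part f) u 1 = I -> y < I - (h 1 - h u) * chord_ratio I ->
     chord y <= sing_sol (right_drift k 0) (right_force f) M (1 - u)).
  { intros u I y Hur HI Hy HIu Hlt.
    apply (sing_sol_ge_chord _ _ _ _ _ (HR 0) HM J (1 - u) I y); auto; try lra.
    - intros r Hr. split; [apply DJ; lra|]. split.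
      + unfold right_drift. pose proof (profile_slope_bounds _ _ _ Hp (1 - r)). lra.
      + unfold right_force, pos_part. rewrite cut_id by lra.
        apply Rlt_le_trans with (2 := Rmax_l _ _). apply Hfpos. lra.
    - intros r Hr. apply Hcap; lra.
    - rewrite right_force_integral by (auto; lra). lra.
    - rewrite right_force_integral by (auto; lra). rewrite HJ by lra. lra. }
  assert (Hright : chord b <= sing_sol (right_drift k 0) (right_force f) M (1 - u0)).
  { destruct h_right as [[HF Hh]|[HF [zeta [xi0 [Hz [Hxi [HI [Hh1 Hh2]]]]]]]].
    - apply (Hstart u0 (Fplus f) b); try lra; [apply Fplus_right; auto|].
      change (sqrt (Fplus f * (2 - Fplus f))) with (chord (Fplus f)) in Hh.
      assert (Hch := chord_pos (Fplus f) ltac:(lra)).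
      assert (Hs : 0 < chord_ratio (Fplus f)) by (apply Rdiv_lt_0_compat; lra).
      apply Rmult_lt_compat_r with (r := chord_ratio (Fplus f)) in Hh; [|exact Hs].
      replace ((1 - Fplus f) / chord (Fplus f) * (Fplus f - Fminus f - eta) * chord_ratio (Fplus f))
        with (Fplus f - b) in Hh by (unfold chord_ratio, b; field; lra).
      lra.
    - replace (1 + zeta - Fminus f - eta) with (1 + zeta - b) in Hh1 by (unfold b; ring).
      replace (1 - Fminus f - eta) with (1 - b) in * by (unfold b; ring).
      replace (1 - zeta - Fminus f - eta) with (1 - zeta - b) in Hh2 by (unfold b; ring).
      (* At most half of the room between b and 1 - zeta is lost on [xi0, 1], the
         rest, measured in w, on [u0, xi0]. *)
      set (y := (1 - zeta + b) / 2).
      assert (Hy : chord y <= sing_sol (right_drift k 0) (right_force f) M (1 - xi0)).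
      { apply (Hstart xi0 (1 - zeta) y); try (unfold y; lra).
        - rewrite <- HI. apply RInt_ext. intros x Hx.
          rewrite Rmin_left, Rmax_right in Hx by lra.
          unfold pos_part. apply Rmax_left, Rlt_le, Hfpos. lra.
        - assert (Ech : sqrt (1 - zeta ^ 2) = chord (1 - zeta)) by (unfold chord; f_equal; ring).
          rewrite Ech in Hh2.
          assert (Hch := chord_pos (1 - zeta) ltac:(lra)).
          assert (Hs : 0 < chord_ratio (1 - zeta)) by (apply Rdiv_lt_0_compat; lra).
          apply Rmult_lt_compat_r with (r := chord_ratio (1 - zeta)) in Hh2; [|exact Hs].
          replace ((1 - zeta - b) / 2 * (zeta / chord (1 - zeta)) * chord_ratio (1 - zeta))
            with ((1 - zeta - b) / 2) in Hh2 by (unfold chord_ratio; field; lra).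
          unfold y. lra. }
      assert (E1 : sqrt (1 - ((1 + zeta - b) / 2) ^ 2) = chord y)
        by (unfold chord, y; f_equal; field).
      assert (E2 : sqrt (1 - (1 - b) ^ 2) = chord b) by (unfold chord; f_equal; ring).
      rewrite E1, E2 in Hh1.
      assert (Hg : sing_sol (right_drift k 0) (right_force f) M (1 - xi0)
          + (J (1 - u0) - J (1 - xi0)) <= sing_sol (right_drift k 0) (right_force f) M (1 - u0)).
      { apply (sing_sol_gain _ _ _ _ _ (HR 0) HM J (right_drift k 0)); auto; try lra.
        - intros r Hr. apply DJ. lra.
        - intros; lra. }
      rewrite !HJ in Hg by lra. lra. }
  destruct (matching_speed f h k K P M u0) as [c [Hc Hmatch]]; auto; try lra.
  { intros c Hc. apply Hcap; lra. }
  exists c. split; [exact Hc|].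
  apply (matched_solution f h k K P M u0 c); auto.
  intros s Hs. apply Hcap; lra.
Qed.
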